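(* Let $n\geq 1$, let $q\in(0,2]$, and let $f,g:\mathbb{R}\to\mathbb{R}$ be continuous nondecreasing functions, with $f$ positive and strictly increasing. Consider the equation $$\mathcal{M}^+_{0,1}(D^2u)=f(u)+g(u)\,|Du|^q\quad\text{in }\mathbb{R}^n .$$ \begin{itemize} \item[(i)] If $\lim_{t\to+\infty}g(t)>0$, then there exists an entire viscosity subsolution $u\in USC(\mathbb{R}^n)$ of this equation if and only if $$q\leq 1\quad\text{and}\quad \int_0^{+\infty}\frac{dt}{(t\,f(t))^{1/2}+(t\,g^+(t))^{1/(2-q)}}=+\infty .$$ \item[(ii)] If $\lim_{t\to+\infty}g(t)=0$, then there exists an entire viscosity subsolution $u\in USC(\mathbb{R}^n)$ of this equation if and only if $$\int_0^{+\infty}\frac{dt}{\left(\int_0^t e^{-2\int_s^t\left(\frac{g^-(\tau)}{f(\tau)}\right)^{2/q}f(\tau)\,d\tau}f(s)\,ds\right)^{1/2}}=+\infty .$$ \item[(iii)] If $\lim_{t\to+\infty}g(t)<0$, then there exists an entire viscosity subsolution $u\in USC(\mathbb{R}^n)$ of this equation if and only if $$\int_0^{+\infty}\left[\frac{1}{(t\,f(t))^{1/2}}+\frac{1}{f(t)^{1/q}}\right]dt=+\infty .$$ \end{itemize}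
   Context: $\mathcal{S}_n$ denotes the space of real symmetric $n\times n$ matrices. For $X\in\mathcal{S}_n$ with eigenvalues $\mu_1(X)\le\dots\le\mu_n(X)$, the degenerate maximal Pucci operator is $\mathcal{M}^+_{0,1}(X)=\sum_{\mu_i(X)>0}\mu_i(X)$. $g^+=\max(g,0)$, $g^-=\max(-g,0)$. $USC(\mathbb{R}^n)$ is the set of upper semicontinuous functions $\mathbb{R}^n\to\mathbb{R}$. A function $u\in USC(\mathbb{R}^n)$ is a viscosity subsolution of $\mathcal{M}^+_{0,1}(D^2u)=f(u)+g(u)|Du|^q$ if for every $x_0\in\mathbb{R}^n$ and every $\phi\in C^2$ such that $u-\phi$ has a local maximum at $x_0$ one has $\mathcal{M}^+_{0,1}(D^2\phi(x_0))\ge f(u(x_0))+g(u(x_0))|D\phi(x_0)|^q$. *)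

(* Defs.v *)
From HB Require Import structures.
From mathcomp Require Import all_boot all_order all_algebra.
From mathcomp Require Import all_classical all_reals all_analysis.
Set Implicit Arguments. Unset Strict Implicit. Unset Printing Implicit Defensive.
Import Order.TTheory GRing.Theory Num.Theory.
Import numFieldNormedType.Exports.
Local Open Scope classical_set_scope.
Local Open Scope ring_scope.

Section Defs.
Variables (R : realType) (n : nat).

Definition evec (i : 'I_n) : 'rV[R]_n := delta_mx 0 i.

Definition partial (phi : 'rV[R]_n -> R) (i : 'I_n) : 'rV[R]_n -> R :=
  fun x => derive phi x (evec i).

Definition C2 (phi : 'rV[R]_n -> R) : Prop :=
  continuous phi /\
  (forall i x, derivable phi x (evec i)) /\
  (forall i, continuous (partial phi i)) /\
  (forall i j x, derivable (partial phi j) x (evec i)) /\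
  (forall i j, continuous (partial (partial phi j) i)).

Definition hessian (phi : 'rV[R]_n -> R) (x : 'rV[R]_n) : 'M[R]_n :=
  \matrix_(i, j) partial (partial phi j) i x.

Definition gradnorm (phi : 'rV[R]_n -> R) (x : 'rV[R]_n) : R :=
  Num.sqrt (\sum_(i < n) (partial phi i x) ^+ 2).

(* M^+_{0,1}(X) = sum of the positive eigenvalues of X (eigenvalues counted
   with multiplicity, i.e. the roots of the characteristic polynomial; for a
   symmetric real matrix the characteristic polynomial splits over R).
   Defaults to 0 if the characteristic polynomial does not split. *)
Definition pucci_plus (X : 'M[R]_n) : R :=
  match pselect (exists s : seq R, char_poly X = \prod_(mu <- s) ('X - mu%:P))
  with
  | left H => \sum_(mu <- projT1 (cid H)) Num.max mu 0
  | right _ => 0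
  end.

Definition usc (u : 'rV[R]_n -> R) : Prop :=
  forall x a, u x < a -> exists2 V, nbhs x V & forall y, V y -> u y < a.

Definition visc_subsol (f g : R -> R) (q : R) (u : 'rV[R]_n -> R) : Prop :=
  forall (x0 : 'rV[R]_n) (phi : 'rV[R]_n -> R), C2 phi ->
    (\forall x \near x0, u x - phi x <= u x0 - phi x0) ->
    pucci_plus (hessian phi x0) >= f (u x0) + g (u x0) * powR (gradnorm phi x0) q.

End Defs.

Definition pospart {R : realType} (g : R -> R) (t : R) : R := Num.max (g t) 0.
Definition negpart {R : realType} (g : R -> R) (t : R) : R := Num.max (- g t) 0.

(* Main.v *)
Require Import Defs.
From HB Require Import structures.
From mathcomp Require Import all_boot all_order all_algebra.
From mathcomp Require Import all_classical all_reals all_analysis.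
From mathcomp Require Import measurable_realfun ring lra.
From mathcomp Require Import spectral complex.
Set Implicit Arguments.
Unset Strict Implicit.
Unset Printing Implicit Defensive.
Import Order.TTheory GRing.Theory Num.Theory.
Import numFieldNormedType.Exports.
Local Open Scope classical_set_scope.
Local Open Scope ring_scope.

(** Everything reduces to one dimension. For [rho > 0] put [P t = 2 \int_0^t rho];
    the solution of [w'' = rho w], [w 0 = w' 0 = 0] satisfies [w' ^ 2 = P w] and is
    entire iff [1 / sqrt P] is not integrable at infinity.
    If [rho t >= f (a + t) + g (a + t) P t ^ (q / 2)], then [u x = a + w x_0] is an
    entire subsolution, because the sum of the positive eigenvalues of a symmetric
    matrix dominates each of its diagonal entries.
    Conversely, if [rho] satisfies the separable version of the reverse inequality
    and [1 / sqrt P] is integrable, then [b + sum_k w x_k] is a supersolution that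
    blows up on the boundary of a cube and starts below [u 0]; comparing it with
    [u] at an interior maximum of the difference is contradictory.
    When [g <= 0], both choices of [rho] are multiples of [P'], where
    [P' = f (1 - 2 k P)] and [k = (g^- / f) ^ (2 / q)]; solving this linear equation
    gives the integral of (ii), and (iii) is a two-sided estimate of [P].
    When [g > 0] at infinity and [q <= 1], the two choices of [P] are
    comparable, up to a dilation of the variable, to [t f + (t g^+) ^ (2 / (2 - q))];
    when [q > 1] the gradient term alone forces blow-up. *)

(** * Calculus on the line *)

(** Since [w' ^ 2 = P w], the squared speed is a function of the value alone, [|Du| ^ q] becomes
    [P ^ (q / 2)], and the natural equation is [P' = 2 (f + g P ^ (q / 2))]. It is never solved:
    each case uses explicit inequalities on both sides. For [g <= 0], [k] is chosen so that
    [g^- P ^ (q / 2) = f (k P) ^ (q / 2)]. The linear equation keeps [z = 2 k P] below [1], where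
    [z <= z ^ (q / 2)] as [q <= 2]; in the converse a small multiple of [P] keeps the gradient term
    below [f / 2]. Hence the exponential weight of (ii). When the gradient term dominates,
    [P' = 2 g P ^ (q / 2)] integrates to [P ^ ((2 - q) / 2) = (2 - q) \int g], the origin of the
    exponent [2 / (2 - q)]; the integral is compared with [t g t] from above and with its value at
    [t / 2] from below, whence the dilation. Barriers are sums over coordinates, not radial
    functions, so that no term [w' / r] enters the Hessian. The price is a factor [n], paid by small
    constants, and an inequality linking each [rho (t_i)] to [f] and [g] at the total value,
    obtained by monotonicity. *)

Section Calculus.
Context {R : realType}.
Implicit Types (F G h : R -> R) (a b x y s t z M : R).

(* The derivation rules of the library concern the ring operations on functions;
   these variants unify with eta-expanded goals. *)
Lemma der_cst (c : R) x : is_derive x 1 (fun _ : R => c) 0.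
Proof. exact: is_derive_cst. Qed.

Lemma der_id x : is_derive x 1 (fun y : R => y) 1.
Proof. exact: is_derive_id. Qed.

Lemma der_add F G x a b : is_derive x 1 F a -> is_derive x 1 G b ->
  is_derive x 1 (fun y => F y + G y) (a + b).
Proof. by move=> dF dG; exact: (is_deriveD dF dG). Qed.

Lemma der_opp F x a : is_derive x 1 F a -> is_derive x 1 (fun y => - F y) (- a).
Proof. by move=> dF; exact: (is_deriveN dF). Qed.

Lemma der_sub F G x a b : is_derive x 1 F a -> is_derive x 1 G b ->
  is_derive x 1 (fun y => F y - G y) (a - b).
Proof. by move=> dF dG; exact: (is_deriveB dF dG). Qed.

Lemma der_mul F G x a b : is_derive x 1 F a -> is_derive x 1 G b ->
  is_derive x 1 (fun y => F y * G y) (a * G x + F x * b).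
Proof.
move=> dF dG; apply: is_derive_eq (is_deriveM dF dG) _.
by rewrite /GRing.scale/=; ring.
Qed.

Lemma der_scale (c : R) F x a : is_derive x 1 F a ->
  is_derive x 1 (fun y => c * F y) (c * a).
Proof.
by move=> dF; apply: is_derive_eq (der_mul (der_cst c x) dF) _; rewrite mul0r add0r.
Qed.

Lemma der_comp F G x a b : is_derive (G x) 1 F a -> is_derive x 1 G b ->
  is_derive x 1 (fun y => F (G y)) (a * b).
Proof. exact: is_derive1_comp. Qed.

Lemma is_derive_continuous F x l : is_derive x 1 F l -> {for x, continuous F}.
Proof. by case=> /derivable1_diffP/differentiable_continuous. Qed.

Lemma derive_continuous F h : (forall x, is_derive x 1 F (h x)) -> continuous F.
Proof. by move=> dF x; exact: is_derive_continuous (dF x). Qed.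

Lemma mean_value F h a b : a < b ->
  (forall x, a <= x <= b -> is_derive x 1 F (h x)) ->
  exists2 c, a < c < b & F b - F a = h c * (b - a).
Proof.
move=> ab dF; have [|x|c] := @MVT R F h a b ab.
- by move=> x; rewrite in_itv/= => /andP[ax xb]; apply: dF; rewrite !ltW.
- apply/continuous_in_subspaceT => z; rewrite inE/= in_itv/= => zab.
  exact: is_derive_continuous (dF z zab).
- by rewrite in_itv/=; exists c.
Qed.

Lemma ger_derive F h a b : a <= b ->
  (forall x, a <= x <= b -> is_derive x 1 F (h x)) ->
  (forall x, a < x < b -> 0 <= h x) -> F a <= F b.
Proof.
rewrite le_eqVlt => /predU1P[->//|ab] dF h0.
have [c cab E] := mean_value ab dF.
by rewrite -subr_ge0 E mulr_ge0 ?h0// subr_ge0 ltW.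
Qed.

Lemma gtr_derive F h a b : a < b ->
  (forall x, a <= x <= b -> is_derive x 1 F (h x)) ->
  (forall x, a < x < b -> 0 < h x) -> F a < F b.
Proof.
move=> ab dF h0; have [c cab E] := mean_value ab dF.
by rewrite -subr_gt0 E mulr_gt0 ?h0// subr_gt0.
Qed.

Lemma eq_is_derive_shift F G h a b : a <= b ->
  (forall x, a <= x <= b -> is_derive x 1 F (h x)) ->
  (forall x, a <= x <= b -> is_derive x 1 G (h x)) ->
  F b - F a = G b - G a.
Proof.
move=> ab dF dG; have dFG x : a <= x <= b -> is_derive x 1 (F - G) (h x - h x).
  by move=> xab; apply: is_deriveB; [exact: dF|exact: dG].
have dGF x : a <= x <= b -> is_derive x 1 (G - F) (h x - h x).
  by move=> xab; apply: is_deriveB; [exact: dG|exact: dF].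
have : (F - G) a <= (F - G) b by apply: (ger_derive ab dFG) => z _; rewrite subrr.
have : (G - F) a <= (G - F) b by apply: (ger_derive ab dGF) => z _; rewrite subrr.
by rewrite !fctE; lra.
Qed.

Lemma continuous_integrable_segment h a b : continuous h ->
  lebesgue_measure.-integrable `[a, b] (EFin \o h).
Proof.
move=> ch; apply: continuous_compact_integrable; first exact: segment_compact.
exact: continuous_subspaceT.
Qed.

Lemma antiderivative h : continuous h ->
  exists2 H : R -> R, H 0 = 0 & forall x, is_derive x 1 H (h x).
Proof.
move=> ch.
pose I a x := \int[lebesgue_measure]_(t in `[a, x]) h t.
have Isplit a b x : a <= b -> b <= x -> I a x = I a b + I b x.
  move=> ab bx.
  have intax := @continuous_integrable_segment h a x ch.
  have := @Rintegral_itvB R h (BLeft a) (BRight x) b.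
  rewrite !bnd_simp => /(_ intax ab bx).
  have -> := @Rintegral_itv_obnd_cbnd R b (BRight x) h.
    by rewrite /I => <-//; rewrite addrC subrK.
  apply: integrableS (@continuous_integrable_segment h b x ch) => //.
  exact: subset_itv_oc_cc.
(* The base point lies strictly below both [x] and [0], so no oriented integral is needed. By [HE]
   every base point below both gives the same value, so the base can be held fixed while
   differentiating. *)
pose H x := I (Num.min x 0 - 1) x - I (Num.min x 0 - 1) 0.
have HE c x : c <= x -> c <= 0 -> H x = I c x - I c 0.
  move=> cx c0; rewrite /H; set d := Num.min x 0 - 1.
  have dx : d <= x by rewrite /d lerBlDr ge_min lerDl ler01.
  have d0 : d <= 0 by rewrite /d lerBlDr ge_min lerDl ler01 orbT.
  have [cd|/ltW dc] := leP c d.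
    by rewrite (Isplit c d x)// (Isplit c d 0)//; lra.
  by rewrite (Isplit d c x)// (Isplit d c 0)//; lra.
exists H; first by rewrite /H subrr.
move=> x; pose c := Num.min x 0 - 1.
have cx : c < x by rewrite /c ltrBlDr gt_min ltrDl ltr01.
have c0 : c <= 0 by rewrite /c lerBlDr ge_min lerDl ler01 orbT.
have [dI dIE] := @continuous_FTC1_closed R h c x (x + 1) (ltac:(by rewrite ltrDl ltr01))
  (@continuous_integrable_segment h _ _ ch) cx (ch x).
have dIx : is_derive x 1 (I c) (h x).
  by apply: (DeriveDef dI); rewrite -derive1E; exact: dIE.
apply: (@near_eq_is_derive _ _ _ (fun y => I c y - I c 0)).
- by near=> y; rewrite (HE c)//; apply: ltW; near: y; exact: lt_nbhsr.
- by rewrite -[h x]subr0; apply: is_deriveB dIx _.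
Unshelve. all: by end_near. Qed.

Lemma integral_antiderivative F h a b : a <= b ->
  (forall x, a <= x <= b -> {for x, continuous h}) ->
  (forall x, a <= x <= b -> is_derive x 1 F (h x)) ->
  (\int[lebesgue_measure]_(t in `[a, b]) (h t)%:E = (F b - F a)%:E)%E.
Proof.
rewrite le_eqVlt => /predU1P[->|ab] ch dF.
  by rewrite set_itv1 integral_set1 subrr.
rewrite (@continuous_FTC2 R h F a b)//.
- apply: continuous_in_subspaceT => x; rewrite inE/= in_itv/=; exact: ch.
- split.
  + by move=> x; rewrite in_itv/= => /andP[ax xb]; have [] := dF x _; rewrite ?ltW.
  + apply: cvg_at_right_filter; apply: is_derive_continuous (dF a _).
    by rewrite lexx ltW.
  + apply: cvg_at_left_filter; apply: is_derive_continuous (dF b _).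
    by rewrite lexx ltW.
- move=> x; rewrite in_itv/= => /andP[ax xb]; rewrite derive1E.
  by have [_ ->] := dF x (ltac:(by rewrite !ltW//)).
Qed.

Lemma Rintegral_antiderivative F h a b : a <= b -> continuous h ->
  (forall x, a <= x <= b -> is_derive x 1 F (h x)) ->
  \int[lebesgue_measure]_(t in [set t : R | a <= t <= b]) h t = F b - F a.
Proof.
have -> : [set t : R | a <= t <= b] = `[a, b]%classic.
  by apply/seteqP; split => x /=; rewrite in_itv.
move=> ab ch dF.
by rewrite /Rintegral (integral_antiderivative ab (fun x _ => ch x) dF).
Qed.

End Calculus.

(** * Quadrature for [w'' = rho w] *)

Section Ode.
Context {R : realType}.
Implicit Types (F G h : R -> R) (a b x y s t z M : R).

Lemma near_eq_continuous F G x :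
  (\near x, F x = G x) -> {for x, continuous F} -> {for x, continuous G}.
Proof.
move=> FG; rewrite /prop_for /continuous_at (nbhs_singleton FG).
exact: cvg_trans (near_eq_cvg FG).
Qed.

(** Here [T] is the time needed to reach a position and [S] the position at a given time;
    unboundedness of [T] in both directions makes the motion entire. *)
Lemma inverse_derive (T m : R -> R) :
  (forall s, is_derive s 1 T (m s)) -> (forall s, 0 < m s) ->
  (forall M, exists2 s, 0 <= s & M <= T s) ->
  (forall M, exists2 s, s <= 0 & T s <= M) ->
  exists2 S : R -> R, cancel S T & forall y, is_derive y 1 S (m (S y))^-1.
Proof.
move=> dT m0 Tup Tdown.
have T_lt s t : s < t -> T s < T t by move=> st; exact: gtr_derive st _ _.
have Tinj : injective T.
  move=> s t Tst; apply/eqP; case: ltgtP => // /T_lt; by rewrite Tst ltxx.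
have cT := derive_continuous dT.
have /choice[S ST] : forall y, exists s, T s = y.
  move=> y; have [b b0 yTb] := Tup y; have [a a0 Tay] := Tdown y.
  have ab : a <= b by apply: le_trans b0.
  have [|c _ <-] := @IVT R T a b y ab (continuous_subspaceT cT).
    by rewrite ge_min le_max Tay yTb orbT.
  by exists c.
exists S => // y; rewrite -{1}[y]ST.
apply: is_derive_inverse (dT (S y)) _; last by rewrite gt_eqF.
- by near=> z; apply: Tinj; rewrite ST.
- by near=> z; exact: cT.
Unshelve. all: by end_near. Qed.

(** Solves [w'' = rho w], [w 0 = w' 0 = 0] by quadrature. Since [1 / sqrt P] is
    singular at [0], the unknown is [S] with [w = S ^ 2]: then [S] inverts the
    primitive of the continuous function [2 / sqrt (P (s ^ 2) / s ^ 2)]. *)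
Lemma ode_solution (rho P H : R -> R) (e : R) :
  continuous rho -> (forall t, 0 <= t -> 0 < rho t) ->
  P 0 = 0 -> (forall t, is_derive t 1 P (2 * rho t)) ->
  (forall t, 1 <= t -> is_derive t 1 H (Num.sqrt (P t))^-1) ->
  (forall M, exists2 t, 1 <= t & M <= H t) ->
  0 < e -> (forall t, 0 <= t <= 1 -> e <= rho t) ->
  exists w w1 : R -> R,
  [/\ forall y, is_derive y 1 w (w1 y),
      forall y, is_derive y 1 w1 (rho (w y)),
      forall y, w1 y ^+ 2 = P (w y),
      forall y, 0 <= w y /\ (y = 0 -> w y = 0) &
      forall M y, 1 <= M -> 2 / Num.sqrt (2 * e) + H M - H 1 <= `|y| ->
        M <= w y].
Proof.
move=> crho rho0 P0 dP dH Hinf e0 erho.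
have Pgt0 t : 0 < t -> 0 < P t.
  move=> t0; rewrite -P0; apply: gtr_derive t0 (fun x _ => dP x) _.
  by move=> x /andP[/ltW x0 _]; rewrite mulr_gt0// rho0.
have cP := derive_continuous dP.
(* [Q] is [P z / z], continued to [0] by the positive value [2 * rho 0]; this removes the
   singularity at the starting point. *)
have /is_derive1_caratheodory[Q [PQ cQ0 Q0]] := dP 0.
have {}PQ z : P z = Q z * z by have := PQ z; rewrite P0 !subr0.
have Qgt0 z : 0 <= z -> 0 < Q z.
  rewrite le_eqVlt => /predU1P[<-|z0]; first by rewrite Q0 mulr_gt0// rho0.
  by rewrite -(pmulr_lgt0 _ z0) -PQ Pgt0.
have cQ : continuous Q.
  move=> z; have [->|z0] := eqVneq z 0; first exact: cQ0.
  apply: (@near_eq_continuous (fun x => P x / x)).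
    near=> x; rewrite PQ mulfK//; near: x.
    by apply: open_nbhs_nbhs; split => //; exact: open_neq.
  by apply: cvgM; [exact: cP|exact: inv_continuous].
pose q s := Num.sqrt (Q (s ^+ 2)).
have q0 s : 0 < q s by rewrite sqrtr_gt0 Qgt0// sqr_ge0.
have cq : continuous q.
  move=> s; apply: (continuous_comp (f := fun s => Q (s ^+ 2))); last exact:
      sqrt_continuous.
  by apply: (continuous_comp (f := fun s => s ^+ 2)); [exact: exprn_continuous|exact:
      cQ].
(* The substitution [t = s ^ 2] in [dt / sqrt (P t)], with [P (s ^ 2) = (s * q s) ^ 2], leaves
   [2 ds / q s]. *)
pose m s := 2 / q s.
have m0 s : 0 < m s by rewrite divr_gt0.
have cm : continuous m.
  by move=> s; apply: cvgM; [exact: cvg_cst|apply: cvgV; [rewrite gt_eqF|exact: cq]].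
have [T T0 dT] := antiderivative cm.
have PE s : P (s ^+ 2) = (s * q s) ^+ 2.
  by rewrite exprMn sqr_sqrtr ?ltW ?Qgt0 ?sqr_ge0// PQ mulrC.
have Todd s : T (- s) = - T s.
  have d0 x : is_derive x 1 (fun s => T s + T (- s)) 0.
    have -> : 0 = m x + m (- x) * (-1) by rewrite /m /q sqrrN mulrN1 subrr.
    by apply: der_add (dT x) (der_comp (dT _) _); exact: der_opp (der_id x).
  have := is_derive_0_is_cst s 0 d0; rewrite oppr0 T0 addr0.
  by move/eqP; rewrite addrC addr_eq0 => /eqP.
have T_lt s t : s < t -> T s < T t by move=> st; exact: gtr_derive st _ _.
have TH t : 1 <= t -> T (Num.sqrt t) = T 1 + H t - H 1.
  move=> t1; have dTs x : 1 <= x <= t ->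
      is_derive x 1 (fun x => T (Num.sqrt x)) (Num.sqrt (P x))^-1.
    move=> /andP[x1 _]; have x0 : 0 < x by apply: lt_le_trans x1.
    have sx0 : 0 < Num.sqrt x by rewrite sqrtr_gt0.
    apply: is_derive_eq (der_comp (dT _) (is_derive1_sqrt x0)) _.
    rewrite -[in RHS](sqr_sqrtr (ltW x0)) PE sqrtr_sqr ger0_norm ?mulr_ge0 1?ltW//.
    by rewrite /m; field; rewrite !gt_eqF.
  have dHs x : 1 <= x <= t -> is_derive x 1 H (Num.sqrt (P x))^-1.
    by move=> /andP[x1 _]; exact: dH.
  by have := eq_is_derive_shift t1 dTs dHs; rewrite sqrtr1; lra.
(* From [rho >= e] on [[0, 1]] follows [P x >= 2 e x] there, so [Q >= 2 e] and
   [m <= 2 / sqrt (2 e)]. *)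
have T1 : T 1 <= 2 / Num.sqrt (2 * e).
  have [c /andP[c0 c1]] := mean_value ltr01 (fun x _ => dT x).
  rewrite T0 !subr0 mulr1 => ->; rewrite ler_pM2l// lef_pV2 ?posrE ?sqrtr_gt0
      ?mulr_gt0 ?Qgt0 ?sqr_ge0//.
  rewrite ler_wsqrtr// -(@ler_pM2r _ (c ^+ 2)) ?exprn_gt0// -PQ.
  have c2 : 0 <= c ^+ 2 by rewrite sqr_ge0.
  have d2 x : 0 <= x <= c ^+ 2 -> is_derive x 1 (fun x => P x - 2 * e * x) (2 * rho x
      - 2 * e * 1).
    by move=> _; apply: der_sub (dP x) (der_scale _ (der_id x)).
  have := ger_derive c2 d2; rewrite P0 mulr0 subrr subr_ge0; apply.
  move=> x /andP[x0 xc]; rewrite mulr1 -mulrBr mulr_ge0// subr_ge0 erho// ltW//=.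
  by apply: ltW; apply: lt_le_trans xc _; rewrite expr_le1// ltW.
have Tup M : exists2 s, 0 <= s & M <= T s.
  have [t t1] := Hinf (M - T 1 + H 1) => MH.
  by exists (Num.sqrt t); rewrite ?sqrtr_ge0// TH//; lra.
have [|S ST dS] := inverse_derive dT m0 Tup.
  move=> M; have [s s0 Ms] := Tup (- M).
  by exists (- s); rewrite ?oppr_le0// Todd lerNl.
pose w y := S y ^+ 2; pose w1 y := S y * q (S y).
have w1E y : w1 y ^+ 2 = P (w y) by rewrite /w1 -PE.
have dw y : is_derive y 1 w (w1 y).
  have -> : w = (fun y => S y * S y) by apply/funext => z; rewrite /w expr2.
  apply: is_derive_eq (der_mul (dS y) (dS y)) _.
  by rewrite /m /w1 invf_div; field.
exists w; exists w1; split; [exact: dw| | exact: w1E| |].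
- move=> y; have cS : {for y, continuous S} := is_derive_continuous (dS y).
  have dsqrtP : S y != 0 -> is_derive y 1 (fun y => Num.sqrt (P (w y)))
      ((2 * Num.sqrt (P (w y)))^-1 * (2 * rho (w y) * w1 y)).
    move=> Sy0; have dPw := der_comp (dP _) (dw y).
    by apply: (der_comp _ dPw); apply: is_derive1_sqrt; rewrite Pgt0// exprn_even_gt0.
  (* [w1] has the sign of [S], so off the zero of [S] it is [sqrt (P w)] or its opposite, and the
     chain rule applies. *)
  have [Sy0|Sy0|Sy0] := ltgtP (S y) 0.
  + apply: (@near_eq_is_derive _ _ _ (fun y => - Num.sqrt (P (w y)))).
      near=> z; have Sz0 : S z < 0 by near: z; exact: (cvgr_lt (S y)).
      by rewrite -w1E sqrtr_sqr ltr0_norm ?opprK// /w1 nmulr_rlt0.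
    apply: is_derive_eq (der_opp (dsqrtP _)) _; first by rewrite lt_eqF.
    rewrite -w1E sqrtr_sqr ltr0_norm ?nmulr_rlt0//.
    by field; rewrite lt_eqF// nmulr_rlt0.
  + apply: (@near_eq_is_derive _ _ _ (fun y => Num.sqrt (P (w y)))).
      near=> z; have Sz0 : 0 < S z by near: z; exact: (cvgr_gt (S y)).
      by rewrite -w1E sqrtr_sqr gtr0_norm// /w1 pmulr_rgt0.
    apply: is_derive_eq (dsqrtP _) _; first by rewrite gt_eqF.
    rewrite -w1E sqrtr_sqr gtr0_norm ?pmulr_rgt0//.
    by field; rewrite gt_eqF// pmulr_rgt0.
  (* At the zero of [S] the square root cannot be differentiated. The slope of [S], times [q (S z)],
     is continuous with value [q 0 ^ 2 / 2 = Q 0 / 2 = rho 0]. *)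
  + have /is_derive1_caratheodory[h [hE ch hy]] := dS y.
    apply/is_derive1_caratheodory; exists (fun z => h z * q (S z)); split.
    * by move=> z; rewrite /w1 Sy0 mul0r subr0 mulrAC -hE Sy0 subr0.
    * apply: cvgM; first exact: ch.
      exact: (continuous_comp cS (cq _)).
    * rewrite hy /m invf_div /w Sy0 expr0n/= [_ / 2]mulrC -mulrA -expr2 /q.
      by rewrite expr0n sqr_sqrtr ?ltW ?Qgt0// Q0; field.
- move=> y; split; first exact: sqr_ge0.
  move=> ->; rewrite /w; suff -> : S 0 = 0 by rewrite expr0n.
  by case: (ltgtP (S 0) 0) => // /T_lt; rewrite ST T0 ltxx.
(* If [w y < M] then [|S y| < sqrt M], and the odd increasing [T] gives [|y| = |T (S y)| < T (sqrt
   M) = T 1 + H M - H 1]. *)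
- move=> M y M1 yM; rewrite leNgt; apply/negP => wM.
  have M0 : 0 <= M by apply: le_trans M1.
  suff : `|y| < T (Num.sqrt M) by rewrite TH//; move: T1 yM; lra.
  have : `|S y| < Num.sqrt M by rewrite -sqrtr_sqr ltr_sqrt// (lt_le_trans ltr01).
  rewrite !ltr_norml => /andP[/T_lt + /T_lt]; by rewrite ST Todd => -> ->.
Unshelve. all: by end_near. Qed.
End Ode.

(** * The Pucci operator *)

Section Pucci.
Context {R : realType} {n : nat}.
Local Open Scope sesquilinear_scope.
Implicit Types (X : 'M[R]_n).

(** A product of monic linear factors determines its roots up to order, so the sequence picked by
    [cid] is immaterial. *)
Lemma pucci_plusE X (s : seq R) :
  char_poly X = \prod_(mu <- s) ('X - mu%:P) ->
  pucci_plus X = \sum_(mu <- s) Num.max mu 0.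
Proof.
move=> Xs; rewrite /pucci_plus; case: pselect => [H|[]]; last by exists s.
apply: perm_big; apply: prod_XsubC_eq; rewrite -Xs.
by case: (cid H).
Qed.

Lemma pucci_plus_diag (d : 'rV[R]_n) :
  pucci_plus (diag_mx d) = \sum_i Num.max (d 0 i) 0.
Proof.
rewrite (@pucci_plusE _ [seq d 0 i | i <- enum 'I_n]).
  by rewrite big_map enumT.
rewrite char_poly_trig ?diag_mx_is_trig// big_map enumT.
by apply: eq_bigr => i _; rewrite mxE eqxx.
Qed.

(** The spectral theorem is applied to the complexified matrix and real parts bring the result back.
    The weights are the squared moduli of the entries of the unitary matrix of eigenvectors, so each
    diagonal entry is a convex combination of eigenvalues. *)
Lemma spectral_symmetric X : X^T = X ->
  exists r : 'I_n -> R, exists W : 'M[R]_n,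
  [/\ char_poly X = \prod_j ('X - (r j)%:P),
      forall j i, 0 <= W j i, forall i, \sum_j W j i = 1 &
      forall i, X i i = \sum_j W j i * r j].
Proof.
move=> Xsym; pose toC : {rmorphism R -> R[i]} := real_complex R.
pose A := map_mx toC X.
have toC_real x : toC x \is Num.real by rewrite complex_real.
have Areal : A \is a realmx by apply/mxOverP => i j; rewrite mxE.
have Asym : A \is symmetricmx.
  by apply/is_hermitianmxP; rewrite expr0 scale1r map_mx_id// /A map_trmx Xsym.
have Aherm := realsym_hermsym Asym Areal.
have /orthomx_spectralP AE := hermitian_normalmx Aherm.
have /mxOverP Dreal := hermitian_spectral_diag_real Aherm.
have Punit := spectral_unit A.
have Puni := spectral_unitarymx A.
set P := spectralmx A in AE Punit Puni; set D := spectral_diag A in AE Dreal.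
pose r j := complex.Re (D 0 j).
have rD j : toC (r j) = D 0 j by rewrite /toC/= RRe_real.
have chA : char_poly A = \prod_j ('X - (D 0 j)%:P).
  have -> : char_poly A = char_poly (diag_mx D).
    have VP : map_mx polyC (invmx P) *m map_mx polyC P = 1%:M.
      by rewrite -map_mxM mulVmx// map_mx1.
    rewrite /char_poly.
    have -> : char_poly_mx A = map_mx polyC (invmx P) *m char_poly_mx (diag_mx D) *m
        map_mx polyC P.
      rewrite /char_poly_mx AE mulmxBr mulmxBl !map_mxM.
      by rewrite mul_mx_scalar -scalemxAl VP scalemx1.
    by rewrite !det_mulmx mulrAC -det_mulmx VP det1 mul1r.
  rewrite char_poly_trig ?diag_mx_is_trig//.
  by apply: eq_bigr => i _; rewrite mxE eqxx.
exists r; exists (\matrix_(j, i) complex.Re (P j i * (P j i)^*)).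
have WE j i : toC (complex.Re (P j i * (P j i)^*)) = P j i * (P j i)^*.
  by rewrite /toC/= RRe_real// ger0_real// mul_conjC_ge0.
split.
- apply: (@map_poly_inj _ _ toC); rewrite map_char_poly -/A chA rmorph_prod/=.
  by apply: eq_bigr => j _; rewrite rmorphB/= map_polyX map_polyC/= rD.
- by move=> j i; rewrite mxE -lecR -/toC WE mul_conjC_ge0.
- move=> i; apply: (fmorph_inj toC); rewrite rmorph_sum rmorph1.
  have /matrixP/(_ i i) : P^t* *m P = 1%:M by rewrite -invmx_unitary// mulVmx.
  rewrite !mxE eqxx mulr1n => <-; apply: eq_bigr => j _.
  by rewrite mxE WE !mxE mulrC.
- move=> i; apply: (fmorph_inj toC); rewrite rmorph_sum.
  have /matrixP/(_ i i) := AE; rewrite invmx_unitary// mxE => ->.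
  rewrite mxE; apply: eq_bigr => j _.
  rewrite mul_mx_diag !mxE [RHS]rmorphM rD WE; ring.
Qed.

(** A diagonal entry is a mean of eigenvalues with weights at most [1]; replacing negative
    eigenvalues by [0] and then the weights by [1] only increases it. *)
Lemma pucci_plus_ge_diag X i : X^T = X -> X i i <= pucci_plus X.
Proof.
move=> /spectral_symmetric[r [W [chX W0 W1 ->]]].
rewrite (@pucci_plusE _ [seq r i | i <- enum 'I_n]).
  rewrite big_map big_enum; apply: ler_sum => j _.
  have W1j : W j i <= 1.
    by rewrite -(W1 i) (bigD1 j)//= lerDl sumr_ge0.
  apply: (@le_trans _ _ (W j i * Num.max (r j) 0)).
    by rewrite ler_wpM2l// le_max lexx.
  by rewrite ler_piMl// le_max lexx orbT.
by rewrite big_map big_enum.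
Qed.

End Pucci.

(** * Second-order calculus in several variables *)

Section Line.
Context {R : realType} {n : nat}.
Implicit Types (f : 'rV[R]_n -> R) (x v : 'rV[R]_n) (s l y : R).

Lemma is_derive_line f x v s l :
  is_derive (s *: v + x) v f l <-> is_derive s 1 (fun t => f (t *: v + x)) l.
Proof.
have E : (fun h : R => h^-1 *: ((f \o shift (s *: v + x)) (h *: v) - f (s *: v + x)))
  = (fun h : R => h^-1 *: (((fun t => f (t *: v + x)) \o shift s) (h *: 1) - f (s *:
      v + x))).
  by apply/funext => h; rewrite /= scalerDl -scalerA scale1r addrA.
by split=> -[dv vl]; apply: DeriveDef; move: dv vl; rewrite /derivable /derive E.
Qed.

Lemma is_derive_coord (w w1 : R -> R) x v j :
  (forall y, is_derive y 1 w (w1 y)) ->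
  is_derive x v (fun x => w (x 0 j)) (w1 (x 0 j) * v 0 j).
Proof.
move=> dw; have xE : x = 0 *: v + x by rewrite scale0r add0r.
rewrite {1}xE; apply/is_derive_line.
rewrite (_ : (fun _ => _) = (fun t => w (t * v 0 j + x 0 j))); last first.
  by apply/funext => t; rewrite !mxE.
apply: der_comp; first by rewrite mul0r add0r; exact: dw.
apply: is_derive_eq (der_add (der_mul (der_id 0) (der_cst _ _)) (der_cst _ _)) _.
by rewrite mulr0 addr0 addr0 mul1r.
Qed.

Lemma is_derive_separable (w w1 : R -> R) (b : R) x v :
  (forall y, is_derive y 1 w (w1 y)) ->
  is_derive x v (fun x => b + \sum_k w (x 0 k)) (\sum_k w1 (x 0 k) * v 0 k).
Proof.
move=> dw; rewrite -[X in is_derive _ _ _ X]add0r.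
have -> : (fun x : 'rV[R]_n => b + \sum_k w (x 0 k)) =
    cst b + \sum_k (fun x : 'rV[R]_n => w (x 0 k)).
  by apply/funext => z; rewrite fctE fct_sumE.
apply: is_deriveD; apply: is_derive_sum => k; exact: is_derive_coord.
Qed.

Lemma evecE (i j : 'I_n) : evec R i 0 j = (j == i)%:R.
Proof. by rewrite /evec mxE eqxx. Qed.

Lemma partial_separable (w w1 : R -> R) (b : R) i :
  (forall y, is_derive y 1 w (w1 y)) ->
  partial (fun x => b + \sum_k w (x 0 k)) i = (fun x => w1 (x 0 i)).
Proof.
move=> dw; apply/funext => x; rewrite /partial.
have [_ ->] := is_derive_separable b x (evec R i) dw.
rewrite (bigD1 i)//= evecE eqxx mulr1 big1 ?addr0// => j ji.
by rewrite evecE (negbTE ji) mulr0.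
Qed.

Lemma partial2_separable (w w1 w2 : R -> R) (b : R) i j :
  (forall y, is_derive y 1 w (w1 y)) -> (forall y, is_derive y 1 w1 (w2 y)) ->
  partial (partial (fun x => b + \sum_k w (x 0 k)) j) i =
    (fun x => w2 (x 0 j) * (j == i)%:R).
Proof.
move=> dw dw1; rewrite (partial_separable _ _ dw); apply/funext => x.
rewrite /partial; have [_ ->] := is_derive_coord x (evec R i) j dw1.
by rewrite evecE.
Qed.

Lemma coord_comp_continuous (h : R -> R) j : continuous h ->
  continuous (fun x : 'rV[R]_n => h (x 0 j)).
Proof.
move=> ch x; apply: (continuous_comp (f := fun x : 'rV[R]_n => x 0 j)).
  exact: coord_continuous.
exact: ch.
Qed.

Lemma separable_continuous (w : R -> R) (b : R) : continuous w ->
  continuous (fun x : 'rV[R]_n => b + \sum_k w (x 0 k)).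
Proof.
move=> cw x; apply: (@cvgD _ _ _ (nbhs x) _ (fun=> b)); first exact: cvg_cst.
apply: (@continuous_big _ _ +%R 0) => [|k _]; [exact: add_continuous|].
exact: coord_comp_continuous.
Qed.

Lemma C2_separable (w w1 w2 : R -> R) (b : R) :
  (forall y, is_derive y 1 w (w1 y)) -> (forall y, is_derive y 1 w1 (w2 y)) ->
  continuous w2 -> C2 (fun x : 'rV[R]_n => b + \sum_k w (x 0 k)).
Proof.
move=> dw dw1 cw2; split; first exact: separable_continuous (derive_continuous dw).
split; first by move=> i x; have [] := is_derive_separable b x (evec R i) dw.
split.
  move=> i; rewrite (partial_separable _ _ dw).
  by apply: coord_comp_continuous; exact: derive_continuous dw1.
split=> i j => [x|].
  rewrite (partial_separable _ _ dw).
  by have [] := is_derive_coord x (evec R i) j dw1.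
rewrite (partial2_separable _ _ _ dw dw1) => x.
apply: (@cvgM _ _ (nbhs x) _ (fun x => w2 (x 0 j)) (fun=> (j == i)%:R)).
  exact: coord_comp_continuous.
exact: cvg_cst.
Qed.

Lemma hessian_separable (w w1 w2 : R -> R) (b : R) x :
  (forall y, is_derive y 1 w (w1 y)) -> (forall y, is_derive y 1 w1 (w2 y)) ->
  hessian (fun x => b + \sum_k w (x 0 k)) x = diag_mx (\row_k w2 (x 0 k)).
Proof.
move=> dw dw1; apply/matrixP => i j; rewrite !mxE.
rewrite (partial2_separable _ _ _ dw dw1) [j == i]eq_sym.
by case: eqVneq => [->|]; rewrite ?mulr1 ?mulr0.
Qed.

End Line.

(** * Symmetry of second partial derivatives *)

Section Schwarz.
Context {R : realType} {n : nat}.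
Implicit Types (phi : 'rV[R]_n -> R) (x : 'rV[R]_n) (s t h : R).

Lemma is_derive_partial phi x i s : C2 phi ->
  is_derive s 1 (fun t => phi (t *: evec R i + x)) (partial phi i (s *: evec R i + x)).
Proof. by case=> _ [d _]; apply/is_derive_line/derivableP. Qed.

Lemma is_derive_partial2 phi x i j s : C2 phi ->
  is_derive s 1 (fun t => partial phi j (t *: evec R i + x))
    (partial (partial phi j) i (s *: evec R i + x)).
Proof. by case=> _ [_ [_ [d _]]]; apply/is_derive_line/derivableP. Qed.

(** The second difference is symmetric in [i] and [j], while the mean value theorem applied along
    [i] and then along [j] singles out one order of differentiation. *)
Lemma double_difference phi x i j h : C2 phi -> 0 < h ->
  exists2 st, (0 <= st.1 <= h) && (0 <= st.2 <= h) &
    phi (h *: evec R i + (h *: evec R j + x)) - phi (h *: evec R i + x)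
    - (phi (h *: evec R j + x) - phi x) =
    partial (partial phi i) j (st.2 *: evec R j + (st.1 *: evec R i + x)) * h * h.
Proof.
move=> phiC2 h0.
have [s /andP[s0 sh]] := mean_value h0 (fun s _ =>
  der_sub (is_derive_partial (h *: evec R j + x) i s phiC2) (is_derive_partial x i s
      phiC2)).
rewrite !scale0r !add0r subr0 => E1.
have [t /andP[t0 th]] := mean_value h0 (fun t _ =>
   is_derive_partial2 (s *: evec R i + x) j i t phiC2).
rewrite !scale0r !add0r subr0 => E2.
exists (s, t); first by rewrite /= !ltW.
rewrite [s *: _ + (h *: _ + x)]addrCA in E1; apply: etrans E1 _.
by congr (_ * _); exact: E2.
Qed.

Lemma dist_half (a b z e : R) :
  `|a - z| < e / 2 -> `|b - z| < e / 2 -> `|a - b| <= e.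
Proof.
move=> az bz; rewrite [a - b](_ : _ = (a - z) - (b - z)); last by ring.
by apply: le_trans (ler_normB _ _) _; lra.
Qed.

(** [C2] speaks of iterated partial derivatives only, and the spectral argument needs a symmetric
    Hessian. Both orders represent the same second difference at points close to [x]; their
    continuity at [x] concludes. *)
Lemma partialC phi x i j : C2 phi ->
  partial (partial phi j) i x = partial (partial phi i) j x.
Proof.
move=> phiC2; apply/eqP; rewrite -subr_eq0 -normr_le0; apply/ler_addgt0Pl => e e0.
rewrite addr0.
have [_ [_ [_ [_ cphi]]]] := phiC2.
have e20 : 0 < e / 2 by rewrite divr_gt0.
have /cvgrPdist_lt/(_ _ e20)/nbhs_ballP[d1 /= d10 near1] := cphi i j x.
have /cvgrPdist_lt/(_ _ e20)/nbhs_ballP[d2 /= d20 near2] := cphi j i x.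
pose d := Num.min d1 d2.
have d0 : 0 < d by rewrite lt_min d10.
(* A displacement with both coefficients in [[0, h]] has norm at most [h * K = d / 2]. *)
pose K := `|evec R i| + `|evec R j| + 1.
have K0 : 0 < K by rewrite ltr_wpDl// addr_ge0.
pose h := d / 2 / K; have h0 : 0 < h by rewrite !divr_gt0.
have small s t k l : 0 <= s <= h -> 0 <= t <= h -> `|evec R k| + `|evec R l| + 1 = K ->
    ball x d (s *: evec R k + (t *: evec R l + x)).
  move=> /andP[s0 sh] /andP[t0 th] KE; rewrite -ball_normE/= distrC addrA addrK.
  apply: (@le_lt_trans _ _ (h * K)).
    apply: le_trans (ler_normD _ _) _; rewrite !normrZ !ger0_norm// -KE.
    have := ler_wpM2r (normr_ge0 (evec R k)) sh.
    by have := ler_wpM2r (normr_ge0 (evec R l)) th; move: (ltW h0); lra.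
  by rewrite /h divfK ?gt_eqF// ltr_pdivrMr// ltr_pMr// ltr1n.
have [[s t] /= /andP[sh th] E1] := double_difference x i j phiC2 h0.
have [[t' s'] /= /andP[th' sh'] E2] := double_difference x j i phiC2 h0.
have E : partial (partial phi i) j (t *: evec R j + (s *: evec R i + x)) =
    partial (partial phi j) i (s' *: evec R i + (t' *: evec R j + x)).
  apply: (@mulIf _ h); first by rewrite gt_eqF.
  apply: (@mulIf _ h); first by rewrite gt_eqF.
  apply: etrans (esym E1) (etrans _ E2); rewrite (addrCA (h *: evec R j)).
  move: (phi _) (phi _) (phi _) (phi _) => a1 a2 a3 a4; ring.
have KE : `|evec R i| + `|evec R j| + 1 = K by [].
have KE' : `|evec R j| + `|evec R i| + 1 = K by rewrite [_ + `|evec R i|]addrC.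
have b1 := small s' t' i j sh' th' KE.
have b2 := small t s j i th sh KE'.
have /= n1 := near1 _ (le_ball (ltac:(by rewrite ge_min lexx) : d <= d1) b1).
have /= n2 := near2 _ (le_ball (ltac:(by rewrite ge_min lexx orbT) : d <= d2) b2).
rewrite E in n2.
exact: dist_half n1 n2.
Qed.

Lemma hessian_sym phi x : C2 phi -> (hessian phi x)^T = hessian phi x.
Proof. by move=> phiC2; apply/matrixP => i j; rewrite !mxE partialC. Qed.

End Schwarz.

(** * Test functions touching a function of one coordinate *)

Section Touching.
Context {R : realType}.

(** Were [F2] positive, [F1] would be positive just to the right of its zero [s0], and [F] would
    increase there. *)
Lemma local_max_derive (F F1 : R -> R) (F2 s0 : R) :
  (forall s : R, is_derive s 1 F (F1 s)) -> is_derive s0 1 F1 F2 ->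
  (\forall s \near s0, F s <= F s0) -> F1 s0 = 0 /\ F2 <= 0.
Proof.
move=> dF dF1 /nbhs_ballP[d /= d0 Fmax].
have inball s : `|s0 - s| < d -> F s <= F s0 by move=> sd; exact: Fmax.
have F10 : F1 s0 = 0.
  have ab : s0 - d < s0 + d by lra.
  have s0ab : s0 \in `](s0 - d), (s0 + d)[ by rewrite in_itv/=; apply/andP; split; lra.
  have [_ <-] := dF s0.
  have [] := @derive1_at_max R F (s0 - d) (s0 + d) s0 (ltW ab) _ s0ab; last by [].
  - by move=> t _; have [] := dF t.
  - move=> t; rewrite in_itv/= => /andP[t1 t2]; apply: inball.
    by rewrite ltr_norml; apply/andP; split; lra.
split=> //; rewrite leNgt; apply/negP => F20.
have /is_derive1_caratheodory[g [gE cg g0]] := dF1.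
have /nbhs_ballP[r /= r0 gpos] : \forall s \near s0, 0 < g s.
  by apply: (cvgr_gt (g s0) cg); rewrite g0.
pose s := s0 + Num.min d r / 2.
have m0 : 0 < Num.min d r by rewrite lt_min d0.
have md : Num.min d r <= d by rewrite ge_min lexx.
have mr : Num.min d r <= r by rewrite ge_min lexx orbT.
have : F s0 < F s.
  apply: gtr_derive (fun t _ => dF t) _; first by rewrite /s; lra.
  move=> t /andP[t1 t2]; have := gE t; rewrite F10 subr0 => ->; rewrite mulr_gt0
      ?subr_gt0//.
  by apply: gpos; rewrite /ball/= ltr_norml /s in t2 *; apply/andP; split; lra.
rewrite ltNge inball//; rewrite /s ltr_norml; apply/andP; split; lra.
Qed.

Context {n : nat}.
Implicit Types (u phi : 'rV[R]_n -> R) (x : 'rV[R]_n).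

Lemma near_line (P : set 'rV[R]_n) x v :
  (\forall y \near x, P y) -> \forall t \near (0 : R), P (t *: v + x).
Proof.
move=> Px; have c : (fun t : R => t *: v + x) @ (0 : R) --> x.
  rewrite -[X in _ --> X](_ : 0 *: v + x = x); last by rewrite scale0r add0r.
  apply: (@cvgD _ _ _ (nbhs (0 : R)) _ (fun t : R => t *: v) (fun=> x)).
    exact: (scalel_continuous).
  exact: cvg_cst.
exact: c.
Qed.

(** On each coordinate line through [x] this is a one-variable maximum. The touched function is
    constant along the directions other than [i], so the first-order condition determines the whole
    gradient of [phi]. *)
Lemma touching_separable phi (w w1 w2 : R -> R) (b : R) (i : 'I_n) x :
  C2 phi ->
  (forall y : R, is_derive y 1 w (w1 y)) ->
  (forall y : R, is_derive y 1 w1 (w2 y)) ->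
  (\forall y \near x, b + w ((y : 'rV[R]_n) 0 i) - phi y <= b + w (x 0 i) - phi x) ->
  [/\ w2 (x 0 i) <= hessian phi x i i & gradnorm phi x = `|w1 (x 0 i)|].
Proof.
move=> phiC2 dw dw1 maxx.
have key j : partial phi j x = (i == j)%:R * w1 (x 0 i) /\
    (i == j)%:R * w2 (x 0 i) <= hessian phi x j j.
  have dl (h h1 : R -> R) (t : R) : (forall y : R, is_derive y 1 h (h1 y)) ->
      is_derive t 1 (fun t => h (t * (i == j)%:R + x 0 i))
        ((i == j)%:R * h1 (t * (i == j)%:R + x 0 i)).
    move=> dh; apply: is_derive_eq (der_comp (dh _) (der_add (der_mul (der_id t)
        (der_cst _ t)) (der_cst _ t))) _.
    by rewrite mul1r mulr0 !addr0 mulrC.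
  have dF (t : R) : is_derive t 1 (fun t => b + w (t * (i == j)%:R + x 0 i) - phi (t
      *: evec R j + x))
     (0 + (i == j)%:R * w1 (t * (i == j)%:R + x 0 i) - partial phi j (t *: evec R j +
         x)).
    by apply: der_sub (der_add (der_cst _ _) (dl _ _ _ dw)) _; exact: is_derive_partial.
  have dF1 : is_derive (0 : R) 1 (fun t => 0 + (i == j)%:R * w1 (t * (i == j)%:R + x
      0 i) - partial phi j (t *: evec R j + x))
     (0 + (i == j)%:R * ((i == j)%:R * w2 (0 * (i == j)%:R + x 0 i)) - partial
         (partial phi j) j (0 *: evec R j + x)).
    by apply: der_sub (der_add (der_cst _ _) (der_scale _ (dl _ _ _ dw1))) _; exact:
        is_derive_partial2.
  have [|] := local_max_derive dF dF1.
    have := near_line (evec R j) maxx; apply: filterS => t.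
    by rewrite !mxE eqxx/= mul0r scale0r !add0r.
  rewrite !mul0r !scale0r !add0r mxE => /eqP; rewrite subr_eq0 => /eqP <-.
  rewrite subr_le0 mulrA => H; split => //; apply: le_trans H.
  by case: (i == j); rewrite ?mul1r ?mul0r.
split; first by have [_] := key i; rewrite eqxx mul1r.
rewrite /gradnorm (bigD1 i)//= big1.
  by have [-> _] := key i; rewrite eqxx mul1r addr0 sqrtr_sqr.
by move=> j ji; have [-> _] := key j; rewrite eq_sym (negbTE ji) mul0r expr0n.
Qed.

End Touching.

(** * Divergent integrals and comparison *)

Section Diverges.
Context {R : realType}.
Implicit Types (h H : R -> R) (c t s M C : R).

(** For continuous [h >= 0] this says that the integral of [h] over [1, +oo)
    is infinite; antiderivatives avoid improper integrals. *)
Definition diverges h :=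
  forall H, (forall t, 1 <= t -> is_derive t 1 H (h t)) ->
  forall M, exists2 t, 1 <= t & M <= H t.

Lemma antiderivative_from1 h : (forall t, 1 <= t -> {for t, continuous h}) ->
  exists H, forall t, 1 <= t -> is_derive t 1 H (h t).
Proof.
(* Freezing [h] to the left of [1] makes it continuous on the whole line. *)
move=> ch; have cmax : continuous (fun t => h (Num.max t 1)).
  move=> t; apply: (@continuous_comp _ _ _ (fun t => Num.max t 1) h).
    by apply: continuous_max; [exact: cvg_id|exact: cvg_cst].
  by apply: ch; rewrite le_max lexx orbT.
have [H _ dH] := antiderivative cmax; exists H => t t1.
by apply: is_derive_eq (dH t) _; rewrite max_l.
Qed.

(** Comparison test after an affine change of variable: the shift passes between a rise [t] and a
    value [b + t], the dilation serves the estimates that look at [[t / 2, t]]. *)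
Lemma diverges_le h1 h2 (C k s c : R) : 0 <= C -> 0 < k -> 1 <= c ->
  1 <= k * c + s ->
  (forall t, 1 <= t -> {for t, continuous h1}) ->
  (forall t, 1 <= t -> 0 <= h1 t) ->
  (forall t, c <= t -> h1 t <= C * h2 (k * t + s)) ->
  diverges h1 -> diverges h2.
Proof.
move=> C0 k0 c1 kc1 ch1 h10 h12 div1 H2 dH2 M.
have [H1 dH1] := antiderivative_from1 ch1.
have C10 : 0 < C + 1 by rewrite ltr_wpDl.
pose K t := C / k * H2 (k * t + s).
have dK t : c <= t -> is_derive t 1 K (C * h2 (k * t + s)).
  move=> ct; have kt : 1 <= k * t + s.
    by apply: le_trans kc1 _; rewrite lerD2r ler_pM2l.
  have dk := der_add (der_scale k (der_id t)) (der_cst s t).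
  have dHk := @der_comp _ H2 (fun t => k * t + s) t _ _ (dH2 _ kt) dk.
  apply: is_derive_eq (der_scale (C / k) dHk) _.
  by field; rewrite gt_eqF.
have H1K t : c <= t -> H1 t - H1 c <= K t - K c.
  move=> ct; have dKH x : c <= x <= t ->
      is_derive x 1 (fun x => K x - H1 x) (C * h2 (k * x + s) - h1 x).
    move=> /andP[cx _]; apply: der_sub; first exact: dK.
    by apply: dH1; apply: le_trans cx.
  have : K c - H1 c <= K t - H1 t.
    by apply: ger_derive ct dKH _ => x /andP[cx _]; rewrite subr_ge0 h12// ltW.
  lra.
(* The comparison holds only beyond [c]; to the left, [H1] cannot exceed [H1 c], so a large enough
   value of [H1] forces [t > c]. *)
have H1mono t : 1 <= t -> t <= c -> H1 t <= H1 c.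
  move=> t1 tc; apply: ger_derive tc _ _ => x /andP[tx _].
    by apply: dH1; apply: le_trans tx.
  by apply: h10; apply: le_trans (ltW tx).
have [t t1 Ht] := div1 H1 dH1 (`|C / k * M| + `|H1 c| + `|K c| + 1).
have [tc|ct] := leP t c.
  have := H1mono t t1 tc; have := ler_norm (H1 c).
  by have := normr_ge0 (C / k * M); have := normr_ge0 (K c); lra.
exists (k * t + s).
  by apply: le_trans kc1 _; rewrite lerD2r ler_pM2l// ltW.
have Ck0 : 0 <= C / k by rewrite divr_ge0// ltW.
have : C / k * M < C / k * H2 (k * t + s).
  have := H1K t (ltW ct); have := ler_norm (C / k * M).
  have := ler_norm (H1 c); have := ler_norm (- K c); rewrite normrN.
  have := ler_norm (- H1 c); rewrite normrN /K; lra.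
move: Ck0; rewrite le_eqVlt => /predU1P[<-|Ck0]; first by rewrite !mul0r ltxx.
by rewrite ltr_pM2l// => /ltW.
Qed.

Lemma not_diverges_bounded h : ~ diverges h ->
  exists H B, (forall t, 1 <= t -> is_derive t 1 H (h t)) /\
    forall t, 1 <= t -> H t <= B.
Proof.
move=> /existsNP[H /not_implyP[dH /existsNP[B nB]]]; exists H, B; split => //.
move=> t t1; rewrite leNgt; apply/negP => Bt; apply: nB.
by exists t => //; exact: ltW.
Qed.

End Diverges.

(** * Maxima of upper semicontinuous functions *)

Section Usc.
Context {R : realType} {n : nat}.
Implicit Types (u v : 'rV[R]_n -> R) (A : set 'rV[R]_n).

Lemma continuous_usc u : continuous u -> usc u.
Proof.
move=> cu x a ua; exists [set y | u y < a] => //.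
exact: (cvgr_lt (u x) (cu x)).
Qed.

Lemma usc_sub u v : usc u -> continuous v -> usc (fun x => u x - v x).
Proof.
move=> uu cv x a uva; pose e := (a - (u x - v x)) / 2.
have e0 : 0 < e by rewrite /e; lra.
have [V Vx uV] := uu x (u x + e) ltac:(lra).
exists (V `&` [set y | v x - e < v y]).
  apply: filterI => //; apply: (cvgr_gt (v x) (cv x)); lra.
by move=> y [/uV + /=]; rewrite /e; lra.
Qed.

Lemma seq_argmax {T : eqType} (d : T -> R) (s : seq T) : s != [::] ->
  exists2 m, m \in s & forall x, x \in s -> d x <= d m.
Proof.
elim: s => // a s IH _; have [->|s0] := eqVneq s [::].
  by exists a; rewrite ?mem_head// => x; rewrite inE => /eqP ->.
have [m ms mmax] := IH s0; have [am|ma] := leP (d a) (d m).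
  exists m; first by rewrite in_cons ms orbT.
  by move=> x; rewrite in_cons => /predU1P[->|/mmax].
exists a; rewrite ?mem_head// => x; rewrite in_cons => /predU1P[->//|/mmax xm].
by apply: le_trans xm (ltW ma).
Qed.

(** Without a maximum the open sets [u < u x], for [x] in [A], cover [A]. In a finite subcover the
    center with the largest value of [u] is left uncovered. *)
Lemma usc_argmax u A : usc u -> compact A -> A !=set0 ->
  exists2 c, A c & forall x, A x -> u x <= u c.
Proof.
move=> uu Acpt [x0 Ax0].
apply: contrapT => nmax.
have H c : A c -> exists2 x, A x & u c < u x.
  move=> Ac; apply: contrapT => nx; apply: nmax; exists c => // x Ax.
  by rewrite leNgt; apply/negP => ucx; apply: nx; exists x.
have : cover_compact A by rewrite -compact_cover.
move=> /(_ _ A (fun x => [set y | u y < u x])).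
case.
- move=> x _; rewrite openE => y /= uyx; rewrite /interior/=.
  have [V Vy uV] := uu y _ uyx; exact: filterS uV Vy.
- move=> y Ay; have [x Ax yx] := H y Ay; by exists x.
move=> D DA cov; have D0 : finmap.enum_fset D != [::].
  apply/eqP => D0; have [i iD _] := cov x0 Ax0.
  have : i \in finmap.enum_fset D := iD; by rewrite D0.
have [m mD mmax] := seq_argmax u D0.
have Am : A m by have := DA m mD; rewrite inE.
have [i /= iD /=] := cov m Am.
by rewrite ltNge mmax.
Qed.
End Usc.

(** * From a choice of [rho] to existence or nonexistence *)

Section Framework.
Context {R : realType}.
Implicit Types (h H rho P f g : R -> R) (a b c t s y M C q : R).

Lemma powR_sqrt_norm c s q : c ^+ 2 = s -> `|c| `^ q = s `^ (q / 2).
Proof.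
move=> cs; rewrite -sqrtr_sqr cs -powR12_sqrt -?cs ?sqr_ge0//.
by rewrite -powRrM mulrC.
Qed.

Lemma inv_sqrt_continuous P t : {for t, continuous P} -> 0 < P t ->
  {for t, continuous (fun t => (Num.sqrt (P t))^-1)}.
Proof.
move=> cP P0; apply: (@cvgV _ _ (nbhs t) _ (fun t => Num.sqrt (P t))).
  by rewrite gt_eqF// sqrtr_gt0.
exact: (continuous_comp cP (@sqrt_continuous R (P t))).
Qed.

Lemma primitive_gt0 rho P : P 0 = 0 -> (forall t, is_derive t 1 P (2 * rho t)) ->
  (forall t, 0 <= t -> 0 < rho t) -> forall t, 0 < t -> 0 < P t.
Proof.
move=> P0 dP rho0 t t0; rewrite -P0; apply: gtr_derive t0 (fun x _ => dP x) _.
by move=> x /andP[/ltW x0 _]; rewrite mulr_gt0// rho0.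
Qed.

Lemma continuous_lower_bound rho : continuous rho ->
  (forall t, 0 <= t -> 0 < rho t) ->
  exists2 e, 0 < e & forall t, 0 <= t <= 1 -> e <= rho t.
Proof.
move=> crho rho0.
have [c c01 cmin] := EVT_min (@ler01 R) (continuous_subspaceT crho).
exists (rho c); first by apply: rho0; move: c01; rewrite in_itv/= => /andP[].
by move=> t t01; apply: cmin; rewrite in_itv.
Qed.

(** At a touching point the gradient norm of the test function equals [sqrt (P w)] and its second
    derivative along the chosen coordinate is at least [rho w]. Having an equality for the gradient
    makes the sign of [g] irrelevant. *)
Lemma exists_subsol n f g q rho P a : (0 < n)%N ->
  continuous rho -> (forall t, 0 <= t -> 0 < rho t) ->
  P 0 = 0 -> (forall t, is_derive t 1 P (2 * rho t)) ->
  diverges (fun t => (Num.sqrt (P t))^-1) ->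
  (forall t, 0 <= t -> f (a + t) + g (a + t) * P t `^ (q / 2) <= rho t) ->
  exists u : 'rV[R]_n -> R, usc u /\ visc_subsol f g q u.
Proof.
move=> n0 crho rho0 P0 dP divP sub.
have Pgt0 := primitive_gt0 P0 dP rho0.
have ciP t : 1 <= t -> {for t, continuous (fun t => (Num.sqrt (P t))^-1)}.
  move=> t1; apply: inv_sqrt_continuous; first exact: derive_continuous dP t.
  by apply: Pgt0; apply: lt_le_trans t1.
have [H dH] := antiderivative_from1 ciP.
have [e e0 erho] := continuous_lower_bound crho rho0.
have [w [w1 [dw dw1 w1E w0 _]]] :=
  ode_solution crho rho0 P0 dP dH (divP H dH) e0 erho.
pose i := Ordinal n0.
exists (fun x => a + w (x 0 i)); split.
  apply: continuous_usc => x.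
  apply: (@cvgD _ _ _ (nbhs x) _ (fun=> a)); first exact: cvg_cst.
  exact: coord_comp_continuous (derive_continuous dw) x.
move=> x phi phiC2 maxx.
have [hess grad] := touching_separable phiC2 dw dw1 maxx.
rewrite grad (powR_sqrt_norm q (w1E _)).
apply: le_trans (sub _ (w0 _).1) _; apply: le_trans hess _.
by apply: pucci_plus_ge_diag; exact: hessian_sym.
Qed.

(** [P] grows at most linearly, and [1 / sqrt t] is not integrable at infinity. This makes the
    truncated barrier entire. *)
Lemma diverges_bounded rho P K : continuous rho -> (forall t, 0 <= t -> 0 < rho t) ->
  P 0 = 0 -> (forall t, is_derive t 1 P (2 * rho t)) ->
  (forall t, 0 <= t -> rho t <= K) -> diverges (fun t => (Num.sqrt (P t))^-1).
Proof.
move=> crho rho0 P0 dP rhoK.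
have Pgt0 := primitive_gt0 P0 dP rho0.
have K0 : 0 < K by apply: lt_le_trans (rhoK 0 _); rewrite ?rho0.
have PK t : 0 <= t -> P t <= 2 * K * t.
  move=> t0; have dKP x : 0 <= x <= t ->
      is_derive x 1 (fun x => 2 * K * x - P x) (2 * K * 1 - 2 * rho x).
    by move=> _; apply: der_sub (der_scale _ (der_id x)) (dP x).
  have : 2 * K * 0 - P 0 <= 2 * K * t - P t.
    apply: ger_derive t0 dKP _ => x /andP[x0 _].
    by have := rhoK x (ltW x0); lra.
  by rewrite P0; lra.
apply: (@diverges_le _ (fun t => (2 * Num.sqrt t)^-1) _ (2 * Num.sqrt (2 * K) / 2) 1
    0 1).
- by rewrite divr_ge0// mulr_ge0// sqrtr_ge0.
- by [].
- by [].
- by lra.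
- move=> t t1; have t0 : 0 < t by apply: lt_le_trans t1.
  apply: (@cvgV _ _ (nbhs t) _ (fun t => 2 * Num.sqrt t)).
    by rewrite gt_eqF// mulr_gt0// sqrtr_gt0.
  by apply: cvgM; [exact: cvg_cst|exact: sqrt_continuous].
- by move=> t _; rewrite invr_ge0 mulr_ge0// sqrtr_ge0.
- move=> t t1; rewrite mul1r addr0; have t0 : 0 < t by apply: lt_le_trans t1.
  have sK : 0 < Num.sqrt (2 * K) by rewrite sqrtr_gt0 mulr_gt0.
  have st : 0 < Num.sqrt t by rewrite sqrtr_gt0.
  have sP : 0 < Num.sqrt (P t) by rewrite sqrtr_gt0 Pgt0.
  have : Num.sqrt (P t) <= Num.sqrt (2 * K) * Num.sqrt t.
    rewrite -sqrtrM; last by rewrite mulr_ge0// ltW.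
    by rewrite ler_wsqrtr// PK// ltW.
  move=> PKt; rewrite ler_pdivlMr// mulrC ler_pdivrMr ?mulr_gt0//.
  by apply: le_trans PKt _; have := mulr_gt0 sK st; lra.
- move=> H dH M; pose t := Num.max 1 ((`|M - H 1 + 1|) ^+ 2).
  have t1 : 1 <= t by rewrite le_max lexx.
  exists t => //.
  have dS x : 1 <= x <= t -> is_derive x 1 Num.sqrt (2 * Num.sqrt x)^-1.
    by move=> /andP[x1 _]; apply: is_derive1_sqrt; apply: lt_le_trans x1.
  have dHt x : 1 <= x <= t -> is_derive x 1 H (2 * Num.sqrt x)^-1.
    by move=> /andP[x1 _]; exact: dH.
  have := eq_is_derive_shift t1 dS dHt; rewrite sqrtr1.
  have : `|M - H 1 + 1| <= Num.sqrt t.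
    by rewrite -[leLHS]ger0_norm// -sqrtr_sqr ler_wsqrtr// le_max lexx orbT.
  by have := ler_norm (M - H 1 + 1); lra.
Qed.


(** The barrier [b + sum_k w (x_k)] has a diagonal Hessian. If the quadrature
    integral were finite it would exceed [u] on the boundary of a fixed cube. *)
Lemma no_subsol n f g q rho P b (u : 'rV[R]_n -> R) :
  {homo f : x y / x < y} -> {homo g : x y / x <= y} ->
  usc u -> visc_subsol f g q u -> b < u 0 ->
  continuous rho -> (forall t, 0 <= t -> 0 < rho t) ->
  P 0 = 0 -> (forall t, is_derive t 1 P (2 * rho t)) ->
  (forall t : 'I_n -> R, (forall i, 0 <= t i) ->
    \sum_i rho (t i) <= f (b + \sum_i t i)
      + g (b + \sum_i t i) * (\sum_i P (t i)) `^ (q / 2)) ->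
  diverges (fun t => (Num.sqrt (P t))^-1).
Proof.
move=> fincr gincr uusc usub bu crho rho0 P0 dP sup; apply: contrapT.
move=> /not_diverges_bounded[H [B [dH HB]]].
have [e e0 erho] := continuous_lower_bound crho rho0.
(* Because [H <= B], the last clause of [ode_solution] shows that the barrier reaches every level
   [M >= 1] within distance [I], uniformly in [M]; the cube can thus be fixed before [M]. *)
pose I := `|2 / Num.sqrt (2 * e) + B - H 1| + 1.
pose A := [set v : 'rV[R]_n | forall i, `[- I, I]%classic (v ord0 i)].
have I0 : 0 < I by rewrite ltr_wpDl.
have A0 : A 0 by move=> i; rewrite /= mxE in_itv/=; apply/andP; split; lra.
have Acpt : compact A by apply: (@rV_compact _ _ (fun=> `[- I, I]%classic)) => i;
    exact: segment_compact.
have [xu Axu umax] := usc_argmax uusc Acpt (ex_intro _ _ A0).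
(* Wherever some [w (x_k)] reaches [M] inside the cube, the barrier is at least the maximum of
   [u]. *)
pose M := Num.max 1 (u xu - b).
have M1 : 1 <= M by rewrite le_max lexx.
have M0 : 0 < M by apply: lt_le_trans M1.
(* Freezing [rho] above the level [M] makes the solution global without
   changing it where it is below [M]. *)
pose rhoM t := rho (Num.min t M).
have crhoM : continuous rhoM.
  move=> t; apply: (@continuous_comp _ _ _ (fun t => Num.min t M) rho); last exact:
      crho.
  by apply: (@continuous_min _ _ id (fun=> M)); [exact: cvg_id|exact: cvg_cst].
have rhoM0 t : 0 <= t -> 0 < rhoM t by move=> t0; rewrite rho0// le_min t0 ltW.
have c2rhoM : continuous (fun t => 2 * rhoM t).
  move=> t; apply: (@cvgM _ _ (nbhs t) _ (fun=> 2) rhoM); [exact: cvg_cst|].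
  exact: crhoM.
have [PM PM0 dPM] := antiderivative c2rhoM.
have rhoME t : t <= M -> rhoM t = rho t by move=> tM; rewrite /rhoM min_l.
have PME t : 0 <= t <= M -> PM t = P t.
  move=> /andP[t0 tM]; have dP' x : 0 <= x <= t -> is_derive x 1 P (2 * rhoM x).
    by move=> /andP[_ xt]; rewrite rhoME ?(le_trans xt).
  by have := eq_is_derive_shift t0 (fun x _ => dPM x) dP'; rewrite PM0 P0 !subr0.
have [c c0M cmax] := EVT_max (ltW M0) (continuous_subspaceT crho).
have rhoMK t : 0 <= t -> rhoM t <= rho c.
  move=> t0; apply: cmax; rewrite in_itv/= le_min t0 ltW//=.
  by rewrite ge_min lexx orbT.
have divPM := diverges_bounded crhoM rhoM0 PM0 dPM rhoMK.
have PMgt0 := primitive_gt0 PM0 dPM rhoM0.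
have ciP t : 1 <= t -> {for t, continuous (fun t => (Num.sqrt (PM t))^-1)}.
  move=> t1; apply: inv_sqrt_continuous; first exact: derive_continuous dPM t.
  by apply: PMgt0; apply: lt_le_trans t1.
have [HM dHM] := antiderivative_from1 ciP.
have erhoM t : 0 <= t <= 1 -> e <= rhoM t.
  by move=> t01; rewrite rhoME ?erho//; case/andP: t01 => _ /le_trans; exact.
have [w [w1 [dw dw1 w1E w0 wM]]] :=
  ode_solution crhoM rhoM0 PM0 dPM dHM (divPM HM dHM) e0 erhoM.
have HME : HM M - HM 1 = H M - H 1.
  apply: (@eq_is_derive_shift _ _ _ (fun t => (Num.sqrt (PM t))^-1) _ _ M1) => x
      /andP[x1 xM]; first exact: dHM.
  by rewrite PME ?(le_trans ler01 x1)//=; exact: dH.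
have wI y : w y < M -> `|y| < I.
  move=> wy; rewrite ltNge; apply/negP => Iy.
  have : M <= w y; last by rewrite leNgt wy.
  apply: wM => //; have := ler_norm (2 / Num.sqrt (2 * e) + B - H 1).
  by have := HB M M1; move: Iy HME; rewrite /I; lra.
pose v (x : 'rV[R]_n) := b + \sum_k w (x 0 k).
have crw : continuous (fun y => rhoM (w y)).
  move=> y; apply: continuous_comp; last exact: crhoM.
  exact: derive_continuous dw y.
have vC2 : C2 v := C2_separable b dw dw1 crw.
have [cv _] := vC2.
(* The difference is positive at the origin, hence at [x1]; so every [w (x1_k)] is below [M], which
   puts [x1] in the interior and in the range where [rhoM] agrees with [rho]. *)
have [x1 Ax1 x1max] := usc_argmax (usc_sub uusc cv) Acpt (ex_intro _ _ A0).
have v0 : v 0 = b.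
  by rewrite /v big1 ?addr0// => k _; rewrite mxE; apply: (w0 0).2.
have uv1 : v x1 < u x1 by have := x1max 0 A0; rewrite v0; lra.
have wlt k : w (x1 0 k) < M.
  apply: (@lt_le_trans _ _ (u xu - b)); last by rewrite le_max lexx orbT.
  rewrite ltrBrDl; apply: le_lt_trans (lt_le_trans uv1 (umax _ Ax1)).
  rewrite /v lerD2l (bigD1 k)//= lerDl sumr_ge0// => j _; exact: (w0 _).1.
have nearA : \forall x \near x1, A x.
  apply: (@filter_forall _ _
    (fun k (x : 'rV[R]_n) => `[- I, I]%classic (x ord0 k)) (nbhs x1)) => k.
  have : \forall x \near x1, `|(x : 'rV[R]_n) 0 k| < I.
    have cn := @coord_comp_continuous R n Num.norm k (@norm_continuous _ R) x1.
    by apply: (cvgr_lt _ cn); exact: wI.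
  by apply: filterS => x; rewrite ltr_norml /= in_itv/= => /andP[*]; rewrite !ltW.
have near_max : \forall x \near x1, u x - v x <= u x1 - v x1.
  by apply: filterS nearA => x /x1max.
have := usub x1 v vC2 near_max.
rewrite (hessian_separable b x1 dw dw1) pucci_plus_diag.
rewrite (_ : \sum_i _ = \sum_i rho (w (x1 0 i))); last first.
  apply: eq_bigr => i _; rewrite mxE rhoME ?ltW// max_l// ltW// rho0//.
  exact: (w0 _).1.
have gE : gradnorm v x1 ^+ 2 = \sum_i P (w (x1 0 i)).
  rewrite /gradnorm sqr_sqrtr; last by apply: sumr_ge0 => i _; rewrite sqr_ge0.
  apply: eq_bigr => i _; rewrite (partial_separable b i dw) w1E PME// (w0 _).1//=.
  exact: ltW.
rewrite -[gradnorm v x1]ger0_norm ?sqrtr_ge0// (powR_sqrt_norm q gE).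
set S := \sum_i P (w (x1 0 i)) => sub1.
have sup1 : \sum_i rho (w (x1 0 i)) <= f (v x1) + g (v x1) * S `^ (q / 2).
  exact: sup (fun i => w (x1 0 i)) (fun i => (w0 _).1).
(* The subsolution inequality carries [f (u x1)] and [g (u x1)], the barrier inequality [f (v x1)]
   and [g (v x1)], with the same gradient; strictness of [f] at [v x1 < u x1] is the
   contradiction. *)
have := fincr _ _ uv1; have := gincr _ _ (ltW uv1) => guv fuv.
have := le_trans sub1 sup1; have := ler_wpM2r (powR_ge0 S (q / 2)) guv; lra.
Qed.

End Framework.

(** * Improper integrals and unbounded primitives *)

Section IntegralTest.
Context {R : realType}.
Implicit Types (h H F : R -> R) (a b c t s x M C : R).
Local Notation mu := (@lebesgue_measure R).

(** The bound [C / sqrt t] makes the contribution of [[0, 1]] finite, so only infinity matters. The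
    value at [0], where an inverse may take its default value, is discarded with the endpoint. *)
Lemma integral_diverges h C :
  (forall t, 0 < t -> {for t, continuous h}) -> (forall t, 0 <= t -> 0 <= h t) ->
  (forall t, 0 < t <= 1 -> h t <= C / Num.sqrt t) ->
  (\int[mu]_(t in [set t : R | (0 <= t)%R]) (h t)%:E = +oo)%E <-> diverges h.
Proof.
move=> ch h0 hC.
have mh : measurable_fun (`]0, +oo[%classic : set R) h.
  apply: open_continuous_measurable_fun; first exact: interval_open.
  by move=> t; rewrite inE/= in_itv/= andbT; exact: ch.
have meh : measurable_fun (`]0, +oo[%classic : set R) (EFin \o h) by
    exact/measurable_EFinP.
have -> : [set t : R | 0 <= t] = `[0, +oo[%classic.
  by apply/seteqP; split => x /=; rewrite in_itv/= andbT.
rewrite -integral_itv_obnd_cbnd//.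
split=> [hoo|divh].
  apply: contrapT => /not_diverges_bounded[H [B [dH HB]]].
  pose F (i : nat) := `[i.+1%:R^-1, i.+1%:R : R]%classic.
  have Fpos i : F i `<=` `]0, +oo[%classic.
    move=> x; rewrite /F /= !in_itv/= andbT => /andP[+ _].
    by apply: lt_le_trans; rewrite invr_gt0.
  have mF i : measurable_fun (F i) (EFin \o h).
    by apply: measurable_funS meh => //; exact: Fpos.
  have cvgF : (\int[mu]_(x in F i) (h x)%:E @[i --> \oo] -->
      \int[mu]_(x in \bigcup_i F i) (h x)%:E)%E.
    apply: ge0_nondecreasing_set_cvg_integral; [|by move=> i; exact:
        measurable_itv|exact: mF|].
    - move=> i j ij; apply/subsetPset => x; rewrite /F /= !in_itv/= => /andP[ix xi].
      apply/andP; split; last by apply: le_trans xi _; rewrite ler_nat.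
      by apply: le_trans ix; rewrite lef_pV2 ?posrE// ler_nat.
    - by move=> i x /Fpos; rewrite /= in_itv/= andbT lee_fin => /ltW; exact: h0.
  have UF : \bigcup_i F i = `]0, +oo[%classic.
    apply/seteqP; split=> [x [i _ /Fpos]//|x]; rewrite /= in_itv/= andbT => x0.
    pose i := (Num.truncn (x + x^-1)).+1.
    have xi : x + x^-1 < i%:R by rewrite /i; exact: truncnS_gt.
    have x'0 : 0 < x^-1 by rewrite invr_gt0.
    exists i => //; rewrite /F /= in_itv/=; apply/andP; split.
      rewrite -[leRHS]invrK lef_pV2 ?posrE//.
      by apply: le_trans (_ : i%:R <= _); [lra|rewrite ler_nat].
    by apply: le_trans (_ : i%:R <= _); [lra|rewrite ler_nat].
  (* [2 * C] comes from the primitive [2 C sqrt x] on the part below [1], and [B - H 1] from the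
     bounded primitive on the rest. *)
  have bound i : (\int[mu]_(x in F i) (h x)%:E <= (2 * C + (B - H 1))%:E)%E.
    have a0 : 0 < (i.+1%:R^-1 : R) by rewrite invr_gt0.
    have a1 : (i.+1%:R^-1 : R) <= 1 by rewrite invf_le1// ler1n.
    have b1 : (1 : R) <= i.+1%:R by rewrite ler1n.
    have C0 : 0 <= C.
      apply: le_trans (h0 1 ler01) _; apply: le_trans (hC 1 _) _; last by rewrite
          sqrtr1 divr1.
      by rewrite ltr01 lexx.
    pose A1 : set R := `[i.+1%:R^-1, 1]%classic.
    pose A2 : set R := `]1, i.+1%:R]%classic.
    have FE : F i = A1 `|` A2.
      apply/seteqP; split => x; rewrite /F /A1 /A2 /= !in_itv/=.
        by case: (leP x 1) => x1 /andP[ax xb]; [left|right]; rewrite ?ax ?xb ?x1.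
      move=> [|] /andP[ax xb]; first by rewrite ax (le_trans xb b1).
      by rewrite (le_trans a1 (ltW ax)) xb.
    have FU (G : set R) : G `<=` F i -> measurable G -> measurable_fun G (EFin \o h).
      by move=> GF mG; apply: measurable_funS (mF i) => //; exact: measurable_itv.
    have h0F x : F i x -> (0 <= (h x)%:E)%E.
      by move=> /Fpos; rewrite /= in_itv/= andbT lee_fin => /ltW; exact: h0.
    have sub1 : A1 `<=` F i by rewrite FE; exact: subsetUl.
    have sub2 : A2 `<=` F i by rewrite FE; exact: subsetUr.
    have disj : [disjoint A1 & A2]%classic.
      apply/disj_setPS => x; rewrite /A1 /A2 /= !in_itv/= => -[/andP[_ x1] /andP[+ _]].
      by rewrite ltNge x1.
    have m12 : measurable_fun (A1 `|` A2) (EFin \o h) by rewrite -FE.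
    have p12 x : (A1 `|` A2) x -> (0 <= (EFin \o h) x)%E by rewrite -FE => /h0F.
    rewrite FE (@ge0_integral_setU _ _ _ mu _ _ _ _ (EFin \o h) m12 p12 disj);
      [|exact: measurable_itv|exact: measurable_itv].
    rewrite EFinD; apply: leeD.
    - have cC : forall x, i.+1%:R^-1 <= x <= 1 ->
          {for x, continuous (fun x : R => C / Num.sqrt x)}.
        move=> x /andP[ax _]; apply: (@cvgM _ _ (nbhs x) _ (fun=> C)).
          exact: cvg_cst.
        apply: (@inv_sqrt_continuous _ id); first exact: cvg_id.
        exact: lt_le_trans ax.
      apply: (@le_trans _ _ (\int[mu]_(x in `[i.+1%:R^-1%R, 1%R]) (C / Num.sqrt
          x)%:E)%E).
        apply: ge0_le_integral => //.
        * exact: measurable_itv.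
        * by move=> x Ax; apply: h0F; exact: (sub1 x Ax).
        * by apply: (FU A1 sub1); exact: measurable_itv.
        * apply/measurable_EFinP; apply: subspace_continuous_measurable_fun; first
            exact: measurable_itv.
          apply: continuous_in_subspaceT => x; rewrite inE /A1/= in_itv; exact: cC.
        * move=> x; rewrite /A1 /= in_itv/= lee_fin => /andP[ax x1]; apply: hC.
          by rewrite x1 (lt_le_trans a0 ax).
      have dsq x : i.+1%:R^-1 <= x <= 1 ->
          is_derive x 1 (fun x => 2 * C * Num.sqrt x) (C / Num.sqrt x).
        move=> /andP[ax _]; have x0 : 0 < x by apply: lt_le_trans ax.
        apply: is_derive_eq (der_scale (2 * C) (is_derive1_sqrt x0)) _.
        by field; rewrite gt_eqF ?sqrtr_gt0.
      have -> := integral_antiderivative a1 cC dsq.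
      by rewrite sqrtr1 mulr1 lee_fin lerBlDr lerDl mulr_ge0 ?sqrtr_ge0// mulr_ge0.
    - rewrite integral_itv_obnd_cbnd; last by apply: (FU A2 sub2); exact:
        measurable_itv.
      have -> : (\int[mu]_(x in `[1%R, i.+1%:R]) (h x)%:E = (H i.+1%:R - H 1)%:E)%E.
        apply: integral_antiderivative b1 _ _ => x /andP[x1 _]; last exact: dH.
        by apply: ch; apply: lt_le_trans x1.
      by rewrite lee_fin; have := HB _ b1; lra.
  move: cvgF; rewrite UF hoo => cvgF.
  have : (+oo <= (2 * C + (B - H 1))%:E)%E.
    by apply: cvge_to_le cvgF _; exact: nearW.
  by rewrite leye_eq.
apply/eqyP => M M0.
have ch1 t : 1 <= t -> {for t, continuous h}.
  by move=> t1; apply: ch; apply: lt_le_trans t1.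
have [H dH] := antiderivative_from1 ch1.
have [t t1 Mt] := divh H dH (M + H 1).
apply: (@le_trans _ _ (\int[mu]_(x in `[1%R, t]) (h x)%:E)%E).
  have -> : (\int[mu]_(x in `[1%R, t]) (h x)%:E = (H t - H 1)%:E)%E.
    apply: integral_antiderivative t1 _ _ => x /andP[x1 _]; last exact: dH.
    by apply: ch; apply: lt_le_trans x1.
  by rewrite lee_fin; lra.
apply: ge0_subset_integral => //.
- by move=> x /=; rewrite in_itv/= andbT lee_fin => /ltW; exact: h0.
- move=> x /=; rewrite !in_itv/= andbT => /andP[x1 _]; exact: lt_le_trans x1.
Qed.

End IntegralTest.

(** * Nonpositive gradient coefficient *)

Section PowR.
Context {R : realType}.
Implicit Types (F h k f : R -> R) (a b c t s x p : R).

Lemma ler_sqrtD (a b : R) : 0 <= a -> 0 <= b ->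
  Num.sqrt (a + b) <= Num.sqrt a + Num.sqrt b.
Proof.
move=> a0 b0; rewrite -[leRHS]ger0_norm ?addr_ge0 ?sqrtr_ge0// -sqrtr_sqr ler_wsqrtr//.
by rewrite sqrrD !sqr_sqrtr// addrAC lerDl mulrn_wge0// mulr_ge0 ?sqrtr_ge0.
Qed.

Lemma powR_continuous_gt0 p x : 0 < x -> {for x, continuous (fun x => x `^ p)}.
Proof.
move=> x0; apply: (@is_derive_continuous _ _ _ ('D_1 (fun x => x `^ p) x)).
apply: derivableP; apply: derivable_powR.
by rewrite in_itv/= x0.
Qed.

Lemma is_derive_powR p x : 0 < x ->
  is_derive x 1 (fun x => x `^ p) (p * x `^ (p - 1)).
Proof.
move=> x0; have x0i : x \in `]0, +oo[ by rewrite in_itv/= x0.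
apply: DeriveDef; first exact: derivable_powR.
by rewrite -derive1E powR_derive1.
Qed.

(** At a zero of [F] the power need not be differentiable; continuity there is read off from
    [F y < e ^ (1 / p)]. *)
Lemma powR_comp_continuous F p t : 0 < p -> (forall x, 0 <= F x) ->
  {for t, continuous F} -> {for t, continuous (fun x => F x `^ p)}.
Proof.
move=> p0 F0 cF; have := F0 t; rewrite le_eqVlt => /predU1P[Ft0|Ft0]; last first.
  apply: (@continuous_comp _ _ _ F (fun x => x `^ p)) => //.
  exact: powR_continuous_gt0.
rewrite /prop_for /continuous_at -Ft0 powR0 ?gt_eqF//.
apply/cvgrPdist_lt => e e0; have ep0 : 0 < e `^ p^-1 by rewrite powR_gt0.
have near1 : \forall y \near t, F y < e `^ p^-1.
  by apply: (cvgr_lt (F t) cF); rewrite -Ft0.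
near=> y; rewrite sub0r normrN ger0_norm ?powR_ge0//.
have Fy : F y < e `^ p^-1 by near: y.
rewrite -[ltRHS](powRr1 (ltW e0)) -(mulVf (lt0r_neq0 p0)) powRrM.
by apply: gt0_ltr_powR => //; rewrite nnegrE ?F0// ltW.
Unshelve. all: by end_near. Qed.

(** Trades an integrating factor for a rational function whose inverse splits into a sum. *)
Lemma ler_expR_inv x : 0 <= x -> x / (1 + x) <= 1 - expR (- x).
Proof.
move=> x0; have x1 : 0 < 1 + x by lra.
rewrite ler_pdivrMr// mulrBl mul1r.
have : expR (- x) * (1 + x) <= 1.
  rewrite expRN mulrC ler_pdivrMr ?expR_gt0// mul1r; exact: expR_ge1Dx.
lra.
Qed.

End PowR.

(** * The linear equation behind the weighted integral *)

Section Weighted.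
Context {R : realType}.
Implicit Types (f k : R -> R) (t s x : R).

(** The bound [2 k P < 1] holds because [k] is nonincreasing and the weight
    integrates [2 k f] exactly. *)
Lemma weighted_primitive f k : continuous f -> continuous k ->
  (forall t, 0 < f t) -> {homo k : x y / x <= y >-> y <= x} ->
  exists P : R -> R,
  [/\ P 0 = 0, forall t, is_derive t 1 P (f t * (1 - 2 * k t * P t)),
      forall t, 0 <= t -> 2 * k t * P t < 1 &
      forall t, 0 <= t ->
        \int[lebesgue_measure]_(s in [set s : R | (0 <= s <= t)%R])
          (expR (- 2 * \int[lebesgue_measure]_(tau in [set tau : R | (s <= tau <= t)%R])
                         (k tau * f tau)) * f s) = P t].
Proof.
move=> cf ck f0 kdec.
have ckf : continuous (fun t => k t * f t).
  by move=> t; apply: (@cvgM _ _ (nbhs t) _ k f); [exact: ck|exact: cf].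
have [A A0 dA] := antiderivative ckf.
have cA := derive_continuous dA.
pose e t := expR (2 * A t).
have de t : is_derive t 1 e (e t * (2 * (k t * f t))).
  exact: (@der_comp _ expR (fun t => 2 * A t) t _ _ (is_derive_expR _) (der_scale 2
      (dA t))).
have ce := derive_continuous de.
have cef : continuous (fun t => e t * f t).
  by move=> t; apply: (@cvgM _ _ (nbhs t) _ e f); [exact: ce|exact: cf].
have [E E0 dE] := antiderivative cef.
have e0 t : 0 < e t by exact: expR_gt0.
(* Variation of constants for [P' = f - 2 k f P], with integrating factor [e]. *)
pose P t := expR (- 2 * A t) * E t.
have eP t : expR (- 2 * A t) = (e t)^-1 by rewrite mulNr expRN.
have dm t : is_derive t 1 (fun t => expR (- 2 * A t)) (expR (- 2 * A t) * (- 2 * (k t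
    * f t))).
  exact: (@der_comp _ expR (fun t => - 2 * A t) t _ _ (is_derive_expR _) (der_scale
      (- 2) (dA t))).
exists P; split.
- by rewrite /P E0 mulr0.
- move=> t; apply: is_derive_eq (der_mul (dm t) (dE t)) _.
  by rewrite /P eP; field; rewrite gt_eqF.
- move=> t t0; rewrite /P eP [2 * k t * _](_ : _ = 2 * k t * E t / e t); last by
    field; rewrite gt_eqF.
  rewrite ltr_pdivrMr// mul1r.
  (* With [k t] frozen, [e - 2 k t E] has derivative [2 e f (k x - k t) >= 0] on [[0, t]] and starts
     from [1]. *)
  have dphi x : 0 <= x <= t -> is_derive x 1 (fun x => e x - 2 * k t * E x)
      (e x * (2 * (k x * f x)) - 2 * k t * (e x * f x)).
    by move=> _; apply: der_sub (de x) (der_scale _ (dE x)).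
  have : e 0 - 2 * k t * E 0 <= e t - 2 * k t * E t.
    apply: ger_derive t0 dphi _ => x /andP[_ /ltW/kdec xt].
    rewrite [leRHS](_ : _ = 2 * (e x * f x) * (k x - k t)); last by ring.
    by rewrite mulr_ge0 ?subr_ge0// mulr_ge0// mulr_ge0// ltW.
  by rewrite E0 mulr0 subr0 /e A0 mulr0 expR0; lra.
- move=> t t0.
  transitivity (\int[lebesgue_measure]_(s in [set s : R | (0 <= s <= t)%R])
      (expR (- 2 * A t) * (e s * f s))).
    apply: eq_Rintegral => s; rewrite inE/= => /andP[s0 st].
    rewrite (Rintegral_antiderivative st ckf (fun x _ => dA x)).
    by rewrite mulrA /e -expRD; congr (expR _ * _); ring.
  have cmf : continuous (fun s => expR (- 2 * A t) * (e s * f s)).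
    move=> s; apply: (@cvgM _ _ (nbhs s) _ (fun=> expR (- 2 * A t)) (fun s => e s * f
        s)).
      exact: cvg_cst.
    exact: cef.
  rewrite (Rintegral_antiderivative t0 cmf (fun s _ => der_scale (expR (- 2 * A t))
      (dE s))).
  by rewrite E0 mulr0 subr0.
Qed.

End Weighted.

(** * Existence criterion for [g <= 0] *)

Section Absorption.
Context {R : realType} (q : R) (f g : R -> R).
Hypotheses (q0 : 0 < q) (q2 : q <= 2).
Hypotheses (cf : continuous f) (cg : continuous g).
Hypotheses (gmono : {homo g : x y / x <= y}) (f0 : forall t, 0 < f t).
Hypothesis fincr : {homo f : x y / x < y}.
Implicit Types (t s x b c : R).

Lemma nondecreasing_of_increasing : {homo f : x y / x <= y}.
Proof. by move=> x y; rewrite le_eqVlt => /predU1P[->//|/fincr/ltW]. Qed.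

(** Where positive, its inverse is the squared speed at which the gradient term balances [f]: the
    exponent is set by [k ^ (q / 2) = g^- / f]. *)
Definition absorption t := (negpart g t / f t) `^ (2 / q).
Local Notation k := absorption.

Lemma negpart_ge0 t : 0 <= negpart g t.
Proof. by rewrite /negpart le_max lexx orbT. Qed.

Lemma negpart_quot_ge0 t : 0 <= negpart g t / f t.
Proof. by rewrite divr_ge0 ?negpart_ge0// ltW. Qed.

Lemma absorption_ge0 t : 0 <= k t. Proof. exact: powR_ge0. Qed.

Lemma absorption_continuous : continuous k.
Proof.
move=> t; apply: (@powR_comp_continuous _ (fun t => negpart g t / f t)).
- by rewrite divr_gt0.
- exact: negpart_quot_ge0.
- apply: (@cvgM _ _ (nbhs t) _ (negpart g) (fun t => (f t)^-1)).
    apply: (@continuous_max _ _ (fun t => - g t) (fun=> 0)); last exact: cvg_cst.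
    by apply: (@cvgN _ _ _ (nbhs t) _ g); exact: cg.
  by apply: (@cvgV _ _ (nbhs t) _ f); [rewrite gt_eqF|exact: cf].
Qed.

Lemma negpart_le : {homo negpart g : x y / x <= y >-> y <= x}.
Proof. by move=> x y xy; rewrite /negpart ge_max !le_max lerN2 gmono//= lexx orbT. Qed.

Lemma absorption_noninc : {homo k : x y / x <= y >-> y <= x}.
Proof.
move=> x y xy; apply: ge0_ler_powR; rewrite ?nnegrE ?negpart_quot_ge0//.
  by rewrite divr_ge0// ltW.
apply: ler_pM; [exact: negpart_ge0|by rewrite invr_ge0 ltW|exact: negpart_le|].
by rewrite lef_pV2 ?posrE// nondecreasing_of_increasing.
Qed.

Lemma absorption_powR t : k t `^ (q / 2) = negpart g t / f t.
Proof.
rewrite /absorption -powRrM (_ : 2 / q * (q / 2) = 1); last by field; rewrite gt_eqF.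
by rewrite powRr1// negpart_quot_ge0.
Qed.

Variable P : R -> R.
Local Notation rho := (fun t => f t * (1 - 2 * k t * P t)).
Hypotheses (P0 : P 0 = 0) (dP : forall t, is_derive t 1 P (rho t)).
Hypothesis P1 : forall t, 0 <= t -> 2 * k t * P t < 1.

Lemma weighted_rho_continuous : continuous rho.
Proof.
move=> t; apply: (@cvgM _ _ (nbhs t) _ f (fun t => 1 - 2 * k t * P t)).
  exact: cf.
apply: cvgB.
  exact: cvg_cst.
apply: (@cvgM _ _ (nbhs t) _ (fun t => 2 * k t) P); last exact: derive_continuous dP t.
apply: (@cvgM _ _ (nbhs t) _ (fun=> 2) k); first exact: cvg_cst.
exact: absorption_continuous.
Qed.

Lemma weighted_rho_gt0 t : 0 <= t -> 0 < rho t.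
Proof. by move=> t0; rewrite mulr_gt0// subr_gt0 P1. Qed.

Lemma weighted_ge0 t : 0 <= t -> 0 <= P t.
Proof.
move=> t0; rewrite -P0; apply: ger_derive t0 (fun x _ => dP x) _.
by move=> x /andP[/ltW x0 _]; rewrite ltW// weighted_rho_gt0.
Qed.

Lemma weighted_gt0 t : 0 < t -> 0 < P t.
Proof.
move=> t0; rewrite -P0; apply: gtr_derive t0 (fun x _ => dP x) _.
by move=> x /andP[/ltW x0 _]; rewrite weighted_rho_gt0.
Qed.

Lemma weighted_rho_le t : 0 <= t -> rho t <= f t.
Proof.
move=> t0; rewrite ger_pMr// gerBl mulr_ge0 ?weighted_ge0// mulr_ge0//.
exact: absorption_ge0.
Qed.

Lemma weighted_inv_sqrt_continuous t : 0 < t ->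
  {for t, continuous (fun t => (Num.sqrt (P t))^-1)}.
Proof.
move=> t0; apply: inv_sqrt_continuous; last exact: weighted_gt0.
exact: derive_continuous dP t.
Qed.

Hypothesis g0 : forall t, g t <= 0.

Lemma negpartE t : negpart g t = - g t.
Proof. by rewrite /negpart max_l// oppr_ge0. Qed.

(* With [z = 2 k P] the inequality to check is [1 - z ^ (q / 2) <= 1 - z],
   which is where [q <= 2] and [z < 1] enter. *)
Lemma absorption_exists n : (0 < n)%N ->
  diverges (fun t => (Num.sqrt (P t))^-1) ->
  exists u : 'rV[R]_n -> R, usc u /\ visc_subsol f g q u.
Proof.
move=> n0 divP.
(* Here [P' = rho], whereas a squared speed has derivative [2 * rho]; hence [2 * P]. *)
apply: (@exists_subsol R n f g q rho (fun t => 2 * P t) 0) => //.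
- exact: weighted_rho_continuous.
- exact: weighted_rho_gt0.
- by rewrite P0 mulr0.
- apply: (@diverges_le _ (fun t => (Num.sqrt (P t))^-1) _ (Num.sqrt 2) 1 0 1) => //.
  + by rewrite addr0 mulr1.
  + move=> t t1; apply: weighted_inv_sqrt_continuous; exact: lt_le_trans t1.
  + move=> t t1; rewrite mul1r addr0 sqrtrM// invfM mulVKf//.
- move=> t t0; rewrite add0r; set z := 2 * k t * P t.
  have z0 : 0 <= z by rewrite !mulr_ge0 ?weighted_ge0 ?absorption_ge0.
  have -> : g t * (2 * P t) `^ (q / 2) = - f t * z `^ (q / 2).
    rewrite (_ : z = k t * (2 * P t)); last by rewrite /z; ring.
    rewrite [(k t * _) `^ _]powRM ?mulr_ge0 ?weighted_ge0 ?absorption_ge0//.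
    by rewrite absorption_powR negpartE; field; rewrite gt_eqF.
  rewrite mulrBr mulr1 lerD2l mulNr lerN2 ler_pM2l//.
  have [->|zn0] := eqVneq z 0; first by rewrite powR_ge0.
  apply: ger1_powR; last by rewrite ler_pdivrMr// mul1r.
  by rewrite lt_neqAle eq_sym zn0 z0 ltW// P1.
Qed.

(* A small multiple of [P], shifted so as to start below [u 0], is the speed of
   a barrier: smallness keeps the gradient term below [f / 2]. *)
Lemma absorption_diverges n : (0 < n)%N ->
  (exists u : 'rV[R]_n -> R, usc u /\ visc_subsol f g q u) ->
  diverges (fun t => (Num.sqrt (P t))^-1).
Proof.
move=> n0 [u [uusc usub]].
pose b := Num.min (u 0) 0 - 1.
have b0 : b < 0 by rewrite /b ltrBlDr add0r gt_min ltr01 orbT.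
have bu : b < u 0.
  by rewrite /b ltrBlDr (le_lt_trans (_ : _ <= u 0))// ?ge_min ?lexx// ltrDl.
have n0' : (0 : R) < n%:R by rewrite ltr0n.
pose N : R := n%:R.
(* As [delta ^ (q / 2) = 1 / 2], keeping [k] times the squared gradient below [delta] keeps the
   gradient term below [f / 2]. *)
pose delta := (1 / 2) `^ (2 / q).
have delta0 : 0 < delta by rewrite powR_gt0.
(* [2 c D] will bound [k (b + t) * S t]: the first summand is the rise from [b] to [0] at constant
   acceleration, the second comes from [2 k P < 1]. *)
pose D := k b * (f 0 * - b) + 1 / 2.
have D0 : 0 < D.
  by rewrite /D ltr_wpDl// mulr_ge0 ?absorption_ge0// mulr_ge0 ?ltW// oppr_gt0.
(* The first bound keeps the sum of second derivatives below [f / 2], the second keeps [k] times the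
   squared gradient, summed over [N] coordinates, below [delta]. *)
pose c := Num.min (f b / (2 * N * f 0)) (delta / (2 * N * D)).
have c0 : 0 < c by rewrite /c lt_min !divr_gt0// ?mulr_gt0// ?f0.
have c1 : N * c * f 0 <= f b / 2.
  have : c <= f b / (2 * N * f 0) by rewrite /c ge_min lexx.
  by rewrite ler_pdivlMr ?mulr_gt0//; lra.
have c2 : N * (2 * c * D) <= delta.
  have : c <= delta / (2 * N * D) by rewrite /c ge_min lexx orbT.
  by rewrite ler_pdivlMr ?mulr_gt0//; lra.
have c3 : N * c <= 1 / 2.
  rewrite -(ler_pM2r (f0 0)); apply: le_trans c1 _.
  by have := nondecreasing_of_increasing (ltW b0); lra.
(* [P] is controlled for nonnegative arguments only, so [rho] is frozen at [rho 0 = f 0] while the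
   value [b + t] is negative. *)
pose r t := c * rho (Num.max (b + t) 0).
have cr : continuous r.
  move=> t; apply: (@cvgM _ _ (nbhs t) _ (fun=> c) (fun t => rho (Num.max (b + t)
      0))); first exact: cvg_cst.
  apply: (@continuous_comp _ _ _ (fun t => Num.max (b + t) 0) rho); last exact:
      weighted_rho_continuous.
  apply: (@continuous_max _ _ (fun t => b + t) (fun=> 0)); last exact: cvg_cst.
  by apply: (@cvgD _ _ _ (nbhs t) _ (fun=> b) id); [exact: cvg_cst|exact: cvg_id].
have r0 t : 0 <= t -> 0 < r t.
  by move=> _; rewrite mulr_gt0// weighted_rho_gt0// le_max lexx orbT.
have c2r : continuous (fun t => 2 * r t).
  by move=> t; apply: (@cvgM _ _ (nbhs t) _ (fun=> 2) r); [exact: cvg_cst|exact: cr].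
have [S S0 dS] := antiderivative c2r.
have b0' : 0 <= - b by rewrite oppr_ge0 ltW.
have Slow t : 0 <= t -> t <= - b -> S t = 2 * c * f 0 * t.
  move=> t0 tb; have dl x : 0 <= x <= t -> is_derive x 1 (fun x => 2 * c * f 0 * x)
      (2 * r x).
    move=> /andP[x0 xt]; apply: is_derive_eq (der_scale _ (der_id x)) _.
    rewrite /r max_r; last by lra.
    by rewrite P0; ring.
  by have := eq_is_derive_shift t0 (fun x _ => dS x) dl; rewrite S0; lra.
have Shigh t : - b <= t -> S t = 2 * c * (f 0 * - b + P (b + t)).
  move=> bt; have dl x : - b <= x <= t -> is_derive x 1 (fun x => 2 * c * P (b + x))
      (2 * r x).
    move=> /andP[x0 xt].
    have dbx := der_add (der_cst b x) (der_id x).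
    apply: is_derive_eq (der_scale (2 * c) (@der_comp _ P (fun x => b + x) x _ _ (dP
        _) dbx)) _.
    by rewrite /r max_l; [ring|lra].
  have := eq_is_derive_shift bt (fun x _ => dS x) dl.
  by rewrite /= subrr P0 (Slow (- b))//; lra.
have SD t : 0 <= t -> k (b + t) * S t <= 2 * c * D.
  move=> t0; have kb : k (b + t) <= k b by apply: absorption_noninc; lra.
  have kt0 := absorption_ge0 (b + t).
  have fb0 : 0 <= f 0 * - b by rewrite mulr_ge0// ltW.
  have kfb : k (b + t) * (f 0 * - b) <= k b * (f 0 * - b) by exact: ler_wpM2r.
  have [tb|bt] := leP t (- b).
    rewrite Slow//; have : k (b + t) * (f 0 * t) <= k (b + t) * (f 0 * - b).
      by rewrite ler_wpM2l// ler_pM2l.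
    rewrite /D => h; rewrite [leLHS](_ : _ = 2 * c * (k (b + t) * (f 0 * t))); last
        by ring.
    by rewrite ler_pM2l ?mulr_gt0//; lra.
  rewrite Shigh; last exact: ltW.
  rewrite [leLHS](_ : _ = 2 * c * (k (b + t) * (f 0 * - b) + k (b + t) * P (b + t)));
      last by ring.
  rewrite ler_pM2l ?mulr_gt0// /D lerD//.
  by have := P1 (t := b + t) ltac:(lra); lra.
have Smono s t : 0 <= s -> s <= t -> S s <= S t.
  move=> s0 st; apply: ger_derive st (fun x _ => dS x) _ => x /andP[sx _].
  by rewrite mulr_ge0// ltW// r0// (le_trans s0)// ltW.
have Sge0 t : 0 <= t -> 0 <= S t by move=> t0; rewrite -S0 Smono.
have divS : diverges (fun t => (Num.sqrt (S t))^-1).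
  apply: (no_subsol fincr gmono uusc usub bu cr r0 S0 dS) => t t0.
  set T := \sum_i t i.
  have tT i : t i <= T by rewrite /T (bigD1 i)//= lerDl sumr_ge0.
  have T0 : 0 <= T by rewrite sumr_ge0.
  have rt i : r (t i) <= f (b + T) / (2 * N).
    rewrite ler_pdivlMr ?mulr_gt0//.
    have rc : r (t i) <= c * f (Num.max (b + t i) 0).
      by rewrite ler_pM2l// weighted_rho_le// le_max lexx orbT.
    apply: (@le_trans _ _ (c * f (Num.max (b + t i) 0) * (2 * N))).
      by rewrite ler_pM2r// mulr_gt0.
    have [bt|bt] := leP 0 (b + t i).
      have := nondecreasing_of_increasing (_ : b + t i <= b + T); rewrite lerD2l =>
          /(_ (tT i)).
      have := ler_wpM2r (ltW (f0 (b + t i))) c3; lra.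
    have := nondecreasing_of_increasing (_ : b <= b + T); rewrite lerDl => /(_ T0).
    by move: c1; lra.
  have sumr : \sum_i r (t i) <= f (b + T) / 2.
    apply: le_trans (ler_sum _ (fun i _ => rt i)) _.
    rewrite sumr_const card_ord -[_ *+ n]mulr_natl.
    rewrite [leLHS](_ : _ = f (b + T) / 2)// /N; field.
    by rewrite pnatr_eq0 -lt0n.
  have sumS : \sum_i S (t i) <= N * S T.
    apply: le_trans (ler_sum _ (fun i _ => Smono _ _ (t0 i) (tT i))) _.
    by rewrite sumr_const card_ord -[_ *+ n]mulr_natl.
  have S0' : 0 <= \sum_i S (t i) by apply: sumr_ge0 => i _; exact: Sge0.
  have kS : (k (b + T) * \sum_i S (t i)) `^ (q / 2) <= 1 / 2.
    have -> : 1 / 2 = delta `^ (q / 2).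
      rewrite /delta -powRrM (_ : 2 / q * (q / 2) = 1); last by field; rewrite gt_eqF.
      by rewrite powRr1.
    apply: ge0_ler_powR; rewrite ?nnegrE.
    - by rewrite divr_ge0// ltW.
    - by rewrite mulr_ge0// absorption_ge0.
    - exact: ltW.
    - apply: le_trans (ler_wpM2l (absorption_ge0 _) sumS) _.
      apply: le_trans c2; rewrite mulrCA ler_pM2l//; exact: SD.
  rewrite powRM ?absorption_ge0// absorption_powR negpartE in kS.
  rewrite mulrAC ler_pdivrMr// in kS.
  by apply: le_trans sumr _; lra.
have sc0 : 0 < Num.sqrt (2 * c) by rewrite sqrtr_gt0 mulr_gt0.
apply: (diverges_le (C := (Num.sqrt (2 * c))^-1) (k := 1) (s := b) (c := 1 - b) _ _ _
    _ _ _ _ divS) => //.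
- by lra.
- by lra.
- move=> t t1; apply: inv_sqrt_continuous; first exact: derive_continuous dS t.
  by apply: (primitive_gt0 S0 dS r0); exact: lt_le_trans t1.
- move=> t bt; rewrite mul1r [t + b]addrC -invfM.
  have Pbt : 0 < P (b + t) by apply: weighted_gt0; lra.
  have sP : 0 < Num.sqrt (P (b + t)) by rewrite sqrtr_gt0.
  have SP : 2 * c * P (b + t) <= S t.
    rewrite Shigh; last by lra.
    by rewrite ler_pM2l ?mulr_gt0// lerDr mulr_ge0// ltW.
  rewrite lef_pV2 ?posrE ?mulr_gt0//; last first.
    by rewrite sqrtr_gt0 (lt_le_trans _ SP)// !mulr_gt0.
  rewrite -sqrtrM; last by rewrite mulr_ge0// ltW.
  exact: ler_wsqrtr.
Qed.

End Absorption.

(** * Two-sided estimate of [P] when [g] stays below a negative constant *)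

Section KellerOsserman.
Context {R : realType} (q : R) (f g : R -> R).
Hypothesis q0 : 0 < q.
Hypotheses (cf : continuous f) (cg : continuous g).
Hypotheses (gmono : {homo g : x y / x <= y}) (f0 : forall t, 0 < f t).
Hypothesis fincr : {homo f : x y / x < y}.
Implicit Types (t s x b c : R).
Local Notation k := (absorption q f g).
Let fmon := nondecreasing_of_increasing fincr.

Lemma inv_sqrt_mul_le t : 0 < t -> (Num.sqrt (t * f t))^-1 <= (Num.sqrt (f 0))^-1 /
    Num.sqrt t.
Proof.
move=> t0; rewrite -invfM -sqrtrM ?(ltW (f0 0))// lef_pV2 ?posrE ?sqrtr_gt0 ?mulr_gt0//.
by rewrite ler_wsqrtr// mulrC ler_pM2l// fmon// ltW.
Qed.

Lemma sqrt_mul_continuous t : {for t, continuous (fun t => Num.sqrt (t * f t))}.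
Proof.
apply: (@continuous_comp _ _ _ (fun t => t * f t) Num.sqrt); last exact:
    sqrt_continuous.
by apply: (@cvgM _ _ (nbhs t) _ id f); [exact: cvg_id|exact: cf].
Qed.

Lemma powR_half t : 0 <= t -> t `^ (1 / 2) = Num.sqrt t.
Proof. by move=> t0; rewrite div1r powR12_sqrt. Qed.

Lemma bounded_absorption_integral :
  (\int[lebesgue_measure]_(t in [set t : R | (0 <= t)%R])
    ((powR (t * f t) (1/2))^-1 + (powR (f t) (1 / q))^-1)%R%:E = +oo)%E <->
  diverges (fun t => (Num.sqrt (t * f t))^-1 + (f t `^ (1 / q))^-1).
Proof.
have q10 : 0 < 1 / q by rewrite divr_gt0.
rewrite -(@integral_diverges _ _ ((Num.sqrt (f 0))^-1 + (f 0 `^ (1 / q))^-1)).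
- rewrite [X in X = _ <-> _](_ : _ = (\int[lebesgue_measure]_(t in [set t : R | (0 <=
    t)%R])
    ((Num.sqrt (t * f t))^-1 + (f t `^ (1 / q))^-1)%:E)%E)//.
  by apply: eq_integral => t; rewrite inE/= => t0; rewrite powR_half// mulr_ge0// ltW.
- move=> t t0; apply: (@cvgD _ _ _ (nbhs t) _ (fun t => (Num.sqrt (t * f t))^-1)).
    apply: (@cvgV _ _ (nbhs t) _ (fun t => Num.sqrt (t * f t))).
      by rewrite gt_eqF// sqrtr_gt0 mulr_gt0.
    exact: sqrt_mul_continuous.
  apply: (@cvgV _ _ (nbhs t) _ (fun t => f t `^ (1 / q))).
    by rewrite gt_eqF// powR_gt0.
  by apply: (@powR_comp_continuous _ f); [exact: q10|move=> x; exact: ltW|exact: cf].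
- by move=> t t0; rewrite addr_ge0// invr_ge0 ?sqrtr_ge0 ?powR_ge0.
- move=> t /andP[t0 t1]; rewrite mulrDl lerD ?inv_sqrt_mul_le//.
  have st0 : 0 < Num.sqrt t by rewrite sqrtr_gt0.
  rewrite ler_pdivlMr//; apply: (@le_trans _ _ ((f t `^ (1 / q))^-1 * 1)).
    by rewrite ler_wpM2l ?invr_ge0 ?powR_ge0// -sqrtr1 ler_wsqrtr.
  rewrite mulr1 lef_pV2 ?posrE ?powR_gt0//.
  by apply: ge0_ler_powR; rewrite ?nnegrE ?(ltW (f0 _)) ?(ltW q10)// fmon// ltW.
Qed.

Variable P : R -> R.
Hypotheses (P0 : P 0 = 0) (dP : forall t, is_derive t 1 P (f t * (1 - 2 * k t * P t))).
Hypothesis P1 : forall t, 0 <= t -> 2 * k t * P t < 1.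

(** A positive lower bound [e] of [P'] on [[0, 1]] gives [P t >= e t], so the singularity at [0] is
    integrable. *)
Lemma weighted_integral :
  (\int[lebesgue_measure]_(t in [set t : R | (0 <= t)%R])
    ((powR (P t) (1/2))^-1)%R%:E = +oo)%E <->
  diverges (fun t => (Num.sqrt (P t))^-1).
Proof.
have crho := weighted_rho_continuous q0 cf cg f0 dP.
have rho0 := weighted_rho_gt0 f0 P1.
have [e e0 erho] := continuous_lower_bound crho rho0.
rewrite -(@integral_diverges _ _ ((Num.sqrt e)^-1)).
- rewrite [X in X = _ <-> _](_ : _ = (\int[lebesgue_measure]_(t in [set t : R | (0 <=
    t)%R])
    ((Num.sqrt (P t))^-1)%:E)%E)//.
  apply: eq_integral => t; rewrite inE/= => t0; rewrite powR_half//.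
  by have Pge0 := weighted_ge0 f0 P0 dP P1; exact: Pge0.
- by move=> t t0; exact: (weighted_inv_sqrt_continuous f0 P0 dP P1 t0).
- by move=> t _; rewrite invr_ge0 sqrtr_ge0.
- move=> t /andP[t0 t1].
  have dl x : 0 <= x <= t -> is_derive x 1 (fun x => P x - e * x)
      (f x * (1 - 2 * k x * P x) - e * 1).
    by move=> _; apply: der_sub (dP x) (der_scale e (der_id x)).
  have : P 0 - e * 0 <= P t - e * t.
    apply: ger_derive (ltW t0) dl _ => x /andP[x0 xt].
    by rewrite mulr1 subr_ge0 erho// ltW//=; apply: le_trans (ltW xt) t1.
  rewrite P0 mulr0 subrr subr_ge0 => eP.
  have et : 0 < e * t by rewrite mulr_gt0.
  rewrite -invfM -sqrtrM ?(ltW e0)// lef_pV2 ?posrE ?sqrtr_gt0//; last exact: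
      lt_le_trans eP.
  exact: ler_wsqrtr.
Qed.

Variable gam : R.
Hypotheses (gam0 : 0 < gam) (gneg : forall t, g t <= - gam).

Let g0 t : g t <= 0. Proof. by apply: le_trans (gneg t) _; rewrite oppr_le0 ltW. Qed.

Lemma weighted_le_mul t : 0 <= t -> P t <= t * f t.
Proof.
move=> t0; have dl x : 0 <= x <= t -> is_derive x 1 (fun x => f t * x - P x)
    (f t * 1 - f x * (1 - 2 * k x * P x)).
  by move=> _; apply: der_sub (der_scale _ (der_id x)) (dP x).
have : f t * 0 - P 0 <= f t * t - P t.
  apply: ger_derive t0 dl _ => x /andP[x0 xt].
  rewrite mulr1 subr_ge0; apply: le_trans (fmon (ltW xt)).
  by have rhole := weighted_rho_le f0 P0 dP P1; exact: rhole (ltW x0).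
by rewrite P0 mulr0 subrr subr_ge0 mulrC.
Qed.

(** There are two upper bounds, [P <= t f] and, from [2 k P < 1] with [g <= - gam],
    [P <= (f / gam) ^ (2 / q)]; each controls one summand. *)
Lemma diverges_weighted_of_bounded :
  diverges (fun t => (Num.sqrt (t * f t))^-1 + (f t `^ (1 / q))^-1) ->
  diverges (fun t => (Num.sqrt (P t))^-1).
Proof.
have q10 : 0 < 1 / q by rewrite divr_gt0.
have gq0 : 0 < gam `^ (1 / q) by rewrite powR_gt0.
apply: (@diverges_le _ _ _ (1 + (gam `^ (1 / q))^-1) 1 0 1) => //.
- by rewrite addr_ge0// invr_ge0 ltW.
- by lra.
- move=> t t1; have t0 : 0 < t by apply: lt_le_trans t1.
  apply: (@cvgD _ _ _ (nbhs t) _ (fun t => (Num.sqrt (t * f t))^-1)).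
    apply: (@cvgV _ _ (nbhs t) _ (fun t => Num.sqrt (t * f t))).
      by rewrite gt_eqF// sqrtr_gt0 mulr_gt0.
    exact: sqrt_mul_continuous.
  apply: (@cvgV _ _ (nbhs t) _ (fun t => f t `^ (1 / q))).
    by rewrite gt_eqF// powR_gt0.
  by apply: (@powR_comp_continuous _ f); [exact: q10|move=> x; exact: ltW|exact: cf].
- by move=> t _; rewrite addr_ge0// invr_ge0 ?sqrtr_ge0 ?powR_ge0.
- move=> t t1; have t0 : 0 < t by apply: lt_le_trans t1.
  have Pt0 := weighted_gt0 f0 P0 dP P1 t0.
  have sP0 : 0 < Num.sqrt (P t) by rewrite sqrtr_gt0.
  rewrite [1 * t]mul1r addr0 mulrDl [1 / Num.sqrt _]mul1r lerD//.
    rewrite lef_pV2 ?posrE ?sqrtr_gt0 ?mulr_gt0//.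
    by rewrite ler_wsqrtr// weighted_le_mul// ltW.
  have ft := f0 t.
  rewrite -invfM lef_pV2 ?posrE ?mulr_gt0 ?powR_gt0//.
  rewrite mulrC -ler_pdivlMr//.
  have -> : f t `^ (1 / q) / gam `^ (1 / q) = Num.sqrt ((f t / gam) `^ (2 / q)).
    rewrite -powR12_sqrt ?powR_ge0// -powRrM (_ : 2 / q / 2 = 1 / q); last by field;
        rewrite gt_eqF.
    by rewrite powRM ?invr_ge0 ?(ltW gam0) ?(ltW ft)// -[gam^-1]powR_inv1 ?(ltW
        gam0)// -powRrM mulN1r powRN.
  rewrite ler_wsqrtr//.
  have kf : 1 <= k t * (f t / gam) `^ (2 / q).
    rewrite /absorption -powRM ?divr_ge0 ?negpart_ge0 ?(ltW gam0) ?(ltW ft)//.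
    rewrite -[leLHS](_ : 1 `^ (2 / q) = 1); last by rewrite powR1.
    apply: ge0_ler_powR; rewrite ?nnegrE//.
    - by rewrite divr_ge0// ltW.
    - by rewrite mulr_ge0 ?(negpart_quot_ge0 g f0)// divr_ge0// ltW.
    - rewrite mulrA divfK ?gt_eqF// ler_pdivlMr// mul1r.
      by rewrite (negpartE g0) lerNr.
  have := P1 (ltW t0); have := weighted_ge0 f0 P0 dP P1 (ltW t0).
  have : 0 <= k t by exact: absorption_ge0.
  move: kf; set z := (f t / gam) `^ _ => kf k0 Pt0' kP.
  have kz : 0 < k t by rewrite lt_neqAle k0 andbT eq_sym; apply/negP => /eqP kt0;
      move: kf; rewrite kt0 mul0r ler10.
  by rewrite -(ler_pM2l kz); lra.
Qed.

(** On [[t / 2, t]] the linear equation either grows freely or saturates near [1 / (2 k)]. Both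
    regimes are contained in [1 / P t <= 1 / (s f s) + 2 k s] with [s = t / 2]. *)
Lemma diverges_bounded_of_weighted :
  diverges (fun t => (Num.sqrt (P t))^-1) ->
  diverges (fun t => (Num.sqrt (t * f t))^-1 + (f t `^ (1 / q))^-1).
Proof.
have q10 : 0 < 1 / q by rewrite divr_gt0.
(* For [s >= 0], [g^- s <= g^- 0], so [sqrt (k s) <= G / f s ^ (1 / q)]. *)
pose G := negpart g 0 `^ (1 / q).
have G0 : 0 <= G by exact: powR_ge0.
apply: (@diverges_le _ _ _ (1 + Num.sqrt 2 * G) 2^-1 0 2) => //.
- by rewrite addr_ge0// mulr_ge0 ?sqrtr_ge0.
- by lra.
- by lra.
- move=> t t1; apply: (weighted_inv_sqrt_continuous f0 P0 dP P1).
  exact: lt_le_trans t1.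
move=> t t2; rewrite addr0; set s := 2^-1 * t.
have s1 : 1 <= s by rewrite /s; lra.
have s0 : 0 < s by apply: lt_le_trans s1.
have t0 : 0 < t by apply: lt_le_trans t2.
have st : s <= t by rewrite /s; lra.
set m := f s; have m0 : 0 < m := f0 s.
set kap := k s.
have kap0 : 0 < kap.
  rewrite /kap /absorption powR_gt0// divr_gt0// (negpartE g0).
  by rewrite oppr_gt0 (le_lt_trans (gneg s))// oppr_lt0.
have Pt0 := weighted_gt0 f0 P0 dP P1 t0.
(* The exponent gained over [[s, t]], whose length [t - s] is again [s]. *)
pose x := 2 * kap * m * s.
have x0 : 0 < x by rewrite !mulr_gt0.
(* On [s, t] one has [P' >= m (1 - 2 kap P)], so an integrating factor applies. *)
have Plow : x / (1 + x) <= 2 * kap * P t.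
  have dexp (y : R) : is_derive y 1 (fun y => expR (2 * kap * m * y)) (expR (2 * kap
      * m * y) * (2 * kap * m * 1)).
    exact: (@der_comp _ expR (fun y => 2 * kap * m * y) y _ _ (is_derive_expR _)
        (der_scale _ (der_id y))).
  have dpsi (y : R) : s <= y <= t -> is_derive y 1
     (fun y => expR (2 * kap * m * y) * (2 * kap * P y - 1))
     (expR (2 * kap * m * y) * (2 * kap * m * 1) * (2 * kap * P y - 1)
       + expR (2 * kap * m * y) * (2 * kap * (f y * (1 - 2 * k y * P y)) - 0)).
    by move=> _; apply: der_mul (dexp y) (der_sub (der_scale _ (dP y)) (der_cst 1 y)).
  have : expR (2 * kap * m * s) * (2 * kap * P s - 1) <= expR (2 * kap * m * t) * (2
      * kap * P t - 1).
    apply: ger_derive st dpsi _ => y /andP[sy yt].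
    have y0 : 0 <= y by apply: le_trans (ltW sy); exact: ltW.
    have Py := weighted_ge0 f0 P0 dP P1 y0.
    rewrite -mulrA -mulrDr mulr_ge0 ?expR_ge0//.
    rewrite [leRHS](_ : _ = 2 * kap * ((f y - m) * (1 - 2 * k y * P y) + 2 * m * P y
        * (kap - k y))); last by ring.
    have h1 : 0 <= f y - m by rewrite subr_ge0 fmon// ltW.
    have h2 : 0 <= 1 - 2 * k y * P y by rewrite subr_ge0 ltW// P1.
    have h3 : 0 <= kap - k y.
      by rewrite subr_ge0 (absorption_noninc q0 gmono f0 fincr)// ltW.
    by rewrite mulr_ge0 ?addr_ge0 ?mulr_ge0// ltW.
  have eE : expR (2 * kap * m * t) = expR x * expR x by rewrite -expRD; congr expR;
      rewrite /x /s; field.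
  rewrite -/x eE -[expR x * expR x * _]mulrA ler_pM2l ?expR_gt0// => h.
  have : -1 <= expR x * (2 * kap * P t - 1).
    have Ps0 := weighted_gt0 f0 P0 dP P1 s0.
    by apply: le_trans h; have := mulr_gt0 kap0 Ps0; lra.
  rewrite -ler_pdivrMl ?expR_gt0// mulrN1 -expRN => h'.
  by apply: le_trans (ler_expR_inv (ltW x0)) _; lra.
have invP : (P t)^-1 <= (s * m)^-1 + 2 * kap.
  have kP0 : 0 < 2 * kap by rewrite mulr_gt0.
  have sm0 : 0 < s * m by rewrite mulr_gt0.
  rewrite -[(P t)^-1]mul1r ler_pdivrMr//.
  have x1 : 0 < 1 + x by lra.
  move: Plow; rewrite ler_pdivrMr// => h.
  rewrite -(ler_pM2l x0).
  rewrite [leRHS](_ : _ = 2 * kap * P t * (1 + x)); first by rewrite mulr1.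
  by rewrite /x; field; rewrite !gt_eqF.
have -> : (Num.sqrt (P t))^-1 = Num.sqrt ((P t)^-1) by rewrite sqrtrV// ltW.
apply: le_trans (ler_wsqrtr invP) _.
apply: le_trans (ler_sqrtD _ _) _; first by rewrite invr_ge0 mulr_ge0// ltW.
  by rewrite mulr_ge0// ltW.
rewrite sqrtrV; last exact: mulr_ge0 (ltW s0) (ltW m0).
have fq0 : 0 < m `^ (1 / q) by rewrite powR_gt0.
have kapG : Num.sqrt (2 * kap) <= Num.sqrt 2 * G * (m `^ (1 / q))^-1.
  rewrite sqrtrM// -mulrA ler_wpM2l ?sqrtr_ge0//.
  rewrite -powR12_sqrt ?(ltW kap0)// /kap /absorption -powRrM.
  rewrite (_ : 2 / q / 2 = 1 / q); last by field; rewrite gt_eqF.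
  rewrite powRM ?(negpart_ge0 g) ?invr_ge0 ?(ltW m0)//.
  rewrite -[(f s)^-1]powR_inv1 ?(ltW m0)// -powRrM mulN1r powRN -/m.
  rewrite ler_wpM2r ?invr_ge0 ?powR_ge0//.
  apply: ge0_ler_powR; rewrite ?nnegrE ?negpart_ge0 ?(ltW q10)//.
  by apply: (negpart_le gmono); exact: ltW.
have i1 : 0 <= (Num.sqrt (s * m))^-1 by rewrite invr_ge0 sqrtr_ge0.
have i2 : 0 <= (m `^ (1 / q))^-1 by rewrite invr_ge0 ltW.
have := mulr_ge0 (mulr_ge0 (sqrtr_ge0 (2 : R)) G0) i1.
by move: kapG i2; lra.
Qed.

End KellerOsserman.

(** * Positive gradient coefficient *)

Section Growth.
Context {R : realType} (q : R) (f g : R -> R).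
Hypothesis q0 : 0 < q.
Hypotheses (cf : continuous f) (cg : continuous g).
Hypotheses (gmono : {homo g : x y / x <= y}) (f0 : forall t, 0 < f t).
Hypothesis fincr : {homo f : x y / x < y}.
Implicit Types (t s x b c tau : R).
Let fmon := nondecreasing_of_increasing fincr.

Lemma small_powR (A e : R) : 0 <= A -> 0 < e ->
  exists2 d, 0 < d & forall x, 0 <= x <= d -> A * x `^ (q / 2) <= e.
Proof.
move=> A0 e0; have A1 : 0 < A + 1 by rewrite ltr_wpDl.
pose d := (e / (A + 1)) `^ (2 / q).
have d0 : 0 < d by rewrite powR_gt0// divr_gt0.
exists d => // x /andP[x0 xd].
have : x `^ (q / 2) <= e / (A + 1).
  have -> : e / (A + 1) = d `^ (q / 2).
    rewrite /d -powRrM (_ : 2 / q * (q / 2) = 1); last by field; rewrite gt_eqF.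
    by rewrite powRr1// ltW// divr_gt0.
  apply: ge0_ler_powR; rewrite ?nnegrE//; first by rewrite divr_ge0// ltW.
  exact: ltW.
rewrite ler_pdivlMr// => h; apply: le_trans h.
by rewrite mulrC ler_wpM2l ?powR_ge0// lerDl.
Qed.

(** [Pi] is the squared speed of the barrier as a function of its value, which
    starts at [b] and rises slowly up to the level [t1], above which [g > 0]. *)
Lemma growth_barrier n b t1 : (0 < n)%N -> b < t1 -> 0 < g t1 ->
  exists2 eta, 0 < eta & forall r Pi : R -> R,
  (forall tau, t1 <= tau -> {for tau, continuous r}) ->
  (forall tau, t1 <= tau -> 0 < r tau) ->
  (forall tau, t1 <= tau -> is_derive tau 1 Pi (2 * r tau)) ->
  Pi t1 = 2 * r t1 * (t1 - b) -> r t1 <= eta ->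
  (forall tau, t1 <= tau ->
    n%:R * r tau <= f tau + g tau * Pi tau `^ (q / 2)) ->
  forall u : 'rV[R]_n -> R, usc u -> visc_subsol f g q u -> b < u 0 ->
  forall (h : R -> R) (C k s c : R), 0 <= C -> 0 < k -> t1 <= c -> 1 + b <= c ->
  1 <= k * c + s ->
  (forall tau, c <= tau -> (Num.sqrt (Pi tau))^-1 <= C * h (k * tau + s)) ->
  diverges h.
Proof.
move=> n0 bt1 gt1; pose N : R := n%:R; pose L := t1 - b.
have N0 : 0 < N by rewrite ltr0n.
have L0 : 0 < L by rewrite subr_gt0.
have [d d0 dsmall] := small_powR (negpart_ge0 g b) (divr_gt0 (f0 b) (ltr0n R 2)).
(* At values below [t1], the first bound keeps [N] times each second derivative under [f b / 2]; the
   second keeps the squared gradient under [d], so a negative [g] costs at most [f b / 2]. *)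
exists (Num.min (f b / (2 * N)) (d / (2 * L))).
  by rewrite lt_min !divr_gt0 ?mulr_gt0.
move=> r Pi cr r0 dPi Pit1; rewrite le_min => /andP[r1 r2] sup u uusc usub bu.
move=> h C k s c C0 k0 t1c bc kc hPi.
have Nr1 : N * r t1 <= f b / 2 by move: r1; rewrite ler_pdivlMr ?mulr_gt0//; lra.
have Lr1 : 2 * r t1 * L <= d by move: r2; rewrite ler_pdivlMr ?mulr_gt0//; lra.
have rt10 := r0 t1 (lexx t1).
pose rho t := r (Num.max (b + t) t1).
have crho : continuous rho.
  move=> t; apply: (@continuous_comp _ _ _ (fun t => Num.max (b + t) t1) r).
    apply: (@continuous_max _ _ (fun t => b + t) (fun=> t1)); last exact: cvg_cst.
    by apply: (@cvgD _ _ _ (nbhs t) _ (fun=> b) id); [exact: cvg_cst|exact: cvg_id].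
  by apply: cr; rewrite le_max lexx orbT.
have rho0 t : 0 <= t -> 0 < rho t by move=> _; rewrite r0// le_max lexx orbT.
have c2rho : continuous (fun t => 2 * rho t).
  by move=> t; apply: (@cvgM _ _ (nbhs t) _ (fun=> 2) rho); [exact: cvg_cst|exact:
      crho].
have [S S0 dS] := antiderivative c2rho.
have Slow t : 0 <= t -> t <= L -> S t = 2 * r t1 * t.
  move=> t0 tL; have dl x : 0 <= x <= t -> is_derive x 1 (fun x => 2 * r t1 * x) (2 *
      rho x).
    move=> /andP[_ xt]; apply: is_derive_eq (der_scale _ (der_id x)) _.
    by rewrite /rho max_r ?mulr1//; move: xt tL; rewrite /L; lra.
  by have := eq_is_derive_shift t0 (fun x _ => dS x) dl; rewrite S0; lra.
have Shigh t : L <= t -> S t = Pi (b + t).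
  move=> Lt; have dl x : L <= x <= t -> is_derive x 1 (fun x => Pi (b + x)) (2 * rho x).
    move=> /andP[Lx _]; have bx : t1 <= b + x by move: Lx; rewrite /L; lra.
    have dbx := der_add (der_cst b x) (der_id x).
    apply: is_derive_eq (@der_comp _ Pi (fun x => b + x) x _ _ (dPi _ bx) dbx) _.
    by rewrite /rho max_l// add0r mulr1.
  have := eq_is_derive_shift Lt (fun x _ => dS x) dl.
  have -> : b + L = t1 by rewrite /L addrC subrK.
  by rewrite (Slow L) ?lexx ?ltW// Pit1 /L; lra.
have Smono x y : 0 <= x -> x <= y -> S x <= S y.
  move=> x0 xy; apply: ger_derive xy (fun z _ => dS z) _ => z /andP[xz _].
  by rewrite mulr_ge0// ltW// rho0// (le_trans x0)// ltW.
have Sge0 t : 0 <= t -> 0 <= S t by move=> t0; rewrite -S0 Smono.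
have divS : diverges (fun t => (Num.sqrt (S t))^-1).
  apply: (no_subsol fincr gmono uusc usub bu crho rho0 S0 dS) => t t0.
  set T := \sum_i t i.
  have tT i : t i <= T by rewrite /T (bigD1 i)//= lerDl sumr_ge0.
  have T0 : 0 <= T by rewrite sumr_ge0.
  have S0' : 0 <= \sum_i S (t i) by apply: sumr_ge0 => i _; exact: Sge0.
  have fbT : f b <= f (b + T) by apply: fmon; rewrite lerDl.
  have small i : t i <= L -> N * rho (t i) <= f b / 2.
    by move=> tL; rewrite /rho max_r//; move: tL; rewrite /L; lra.
  suff each i : N * rho (t i) <= f (b + T) + g (b + T) * (\sum_i S (t i)) `^ (q / 2).
    rewrite -(ler_pM2l N0) mulr_sumr.
    apply: le_trans (ler_sum _ (fun i _ => each i)) _.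
    by rewrite sumr_const card_ord -[_ *+ n]mulr_natl.
  (* Up to a total rise [L] the sign of [g] is unknown and smallness decides. Beyond it [g > 0], and
     the gradient sum may be bounded below by a single coordinate. *)
  have [TL|LT] := leP T L.
    apply: le_trans (small i (le_trans (tT i) TL)) _.
    have sumS : \sum_i S (t i) = 2 * r t1 * T.
      by rewrite /T mulr_sumr; apply: eq_bigr => j _; rewrite Slow// (le_trans (tT j)).
    have : negpart g b * (\sum_i S (t i)) `^ (q / 2) <= f b / 2.
      apply: dsmall; rewrite S0' sumS /=; apply: le_trans Lr1.
      by rewrite ler_pM2l// mulr_gt0.
    have : - negpart g b <= g (b + T).
      apply: (@le_trans _ _ (g b)); last by apply: gmono; rewrite lerDl.
      by rewrite lerNl /negpart le_max lexx.
    move=> /(ler_wpM2r (powR_ge0 (\sum_i S (t i)) (q / 2))); lra.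
  have gT : 0 < g (b + T).
    by apply: lt_le_trans gt1 _; apply: gmono; move: LT; rewrite /L; lra.
  have [tL|Lt] := leP (t i) L.
    apply: le_trans (small i tL) _.
    by have := mulr_ge0 (ltW gT) (powR_ge0 (\sum_i S (t i)) (q / 2)); have := f0 b; lra.
  have bti : t1 <= b + t i by move: Lt; rewrite /L; lra.
  rewrite /rho max_l//; apply: le_trans (sup _ bti) _.
  apply: lerD; first by apply: fmon; rewrite lerD2l.
  have gi : 0 <= g (b + t i) by apply: le_trans (ltW gt1) _; exact: gmono.
  apply: ler_pM => //; first exact: powR_ge0.
    by apply: gmono; rewrite lerD2l.
  rewrite -(Shigh _ (ltW Lt)); apply: ge0_ler_powR; rewrite ?nnegrE//.
  - by rewrite divr_ge0// ltW.
  - exact: Sge0.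
  - by rewrite (bigD1 i)//= lerDl sumr_ge0// => j _; exact: Sge0.
apply: (diverges_le (h2 := h) C0 k0 (s := k * b + s) (c := c - b) _ _ _ _ _ divS).
- by lra.
- by rewrite mulrBr; lra.
- move=> t t1'; apply: inv_sqrt_continuous; first exact: derive_continuous dS t.
  by apply: (primitive_gt0 S0 dS rho0); exact: lt_le_trans t1'.
- by move=> t _; rewrite invr_ge0 sqrtr_ge0.
- move=> t ct; rewrite Shigh; last by rewrite /L; lra.
  rewrite [k * t + _](_ : _ = k * (b + t) + s); last by ring.
  by apply: hPi; lra.
Qed.

End Growth.

(** * Nonexistence for a superlinear gradient term *)

Section GrowthCases.
Context {R : realType} (q : R) (f g : R -> R).
Hypothesis q0 : 0 < q.
Hypotheses (cf : continuous f) (cg : continuous g).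
Hypotheses (gmono : {homo g : x y / x <= y}) (f0 : forall t, 0 < f t).
Hypothesis fincr : {homo f : x y / x < y}.
Implicit Types (t s x b c z tau : R).
Let fmon := nondecreasing_of_increasing fincr.

Lemma not_diverges_powR (p : R) : 0 < p -> ~ diverges (fun z => (z `^ (1 + p))^-1).
Proof.
move=> p0 div; have dH z : 1 <= z ->
    is_derive z 1 (fun z => - p^-1 * z `^ (- p)) (z `^ (1 + p))^-1.
  move=> z1; have z0 : 0 < z by apply: lt_le_trans z1.
  apply: is_derive_eq (der_scale _ (is_derive_powR (- p) z0)) _.
  rewrite -powRN (_ : - p - 1 = - (1 + p)); last by ring.
  by field; rewrite gt_eqF.
have [z z1] := div _ dH 1; apply/negP; rewrite -ltNge.
by apply: le_lt_trans ltr01; rewrite mulNr oppr_le0 mulr_ge0 ?powR_ge0// invr_ge0 ltW.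
Qed.

(* The squared speed of the barrier grows like [z ^ (q + 1)], an exponent above
   [2]; the scale [lam] is large so that the gradient term dominates for [z > 2]. *)
Lemma growth_superlinear_no_subsol n t1 (u : 'rV[R]_n -> R) : (0 < n)%N ->
  1 < q -> 0 < g t1 -> usc u -> visc_subsol f g q u -> False.
Proof.
move=> n0 q1 gt1 uusc usub.
pose b := Num.min (u 0) t1 - 1.
have bu : b < u 0 by have : Num.min (u 0) t1 <= u 0; [rewrite ge_min lexx|rewrite /b;
    lra].
have bt1 : b < t1 by have : Num.min (u 0) t1 <= t1; [rewrite ge_min lexx orbT|rewrite
    /b; lra].
pose L := t1 - b; have L0 : 0 < L by rewrite subr_gt0.
have [eta eta0 barrier] := growth_barrier q0 gmono f0 fincr n0 bt1 gt1.
pose N : R := n%:R; have N0 : 0 < N by rewrite ltr0n.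
have q10 : 0 < q + 1 by lra.
have p2q : 0 < 2 `^ q :> R by rewrite powR_gt0.
(* [eta] limits the initial acceleration; the other bound lets [f] alone dominate [N * r] up to
   [z = 2]. *)
pose kap := Num.min eta (f t1 / (N * 2 `^ q)).
have kap0 : 0 < kap by rewrite lt_min eta0 divr_gt0// mulr_gt0.
have kap1 : kap <= eta by rewrite ge_min lexx.
have kap2 : N * kap * 2 `^ q <= f t1.
  have : kap <= f t1 / (N * 2 `^ q) by rewrite ge_min lexx orbT.
  by rewrite ler_pdivlMr ?mulr_gt0//; lra.
(* With [g t1 * M = N * kap], the gradient inequality reduces to [Pi ^ (q / 2) >= M z ^ q]. *)
pose M := N * kap / g t1.
have M0 : 0 < M by rewrite divr_gt0// mulr_gt0.
(* Gives the primitive of [2 r] the coefficient [2 M ^ (2 / q)]; its factor [2] absorbs the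
   subtracted [1] once [z >= 2]. *)
pose lam := (q + 1) / kap * M `^ (2 / q).
have lam0 : 0 < lam by rewrite mulr_gt0 ?powR_gt0// divr_gt0.
have lamM : kap * lam / (q + 1) = M `^ (2 / q).
  by rewrite /lam; field; rewrite !gt_eqF.
have lamM0 : 0 < M `^ (2 / q) by rewrite powR_gt0.
pose z tau := 1 + lam^-1 * (tau - t1).
have z1 tau : t1 <= tau -> 1 <= z tau.
  by move=> h; rewrite /z lerDl mulr_ge0 ?invr_ge0 ?subr_ge0// ltW.
have dz tau : is_derive tau 1 z lam^-1.
  apply: is_derive_eq (der_add (der_cst _ _) (der_scale _ (der_sub (der_id tau)
      (der_cst _ _)))) _.
  by rewrite add0r subr0 mulr1.
pose r tau := kap * z tau `^ q.
pose Pi tau := 2 * kap * L + 2 * M `^ (2 / q) * (z tau `^ (q + 1) - 1).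
have zt1 : z t1 = 1 by rewrite /z subrr mulr0 addr0.
have PiM tau : t1 <= tau -> 2 <= z tau -> M `^ (2 / q) * z tau `^ (q + 1) <= Pi tau.
  move=> tt1 z2; have : z tau <= z tau `^ (q + 1) by apply: le1r_powR; [exact: z1|lra].
  move=> zq; have : M `^ (2 / q) * 2 <= M `^ (2 / q) * z tau `^ (q + 1).
    by rewrite ler_pM2l//; lra.
  by have := mulr_gt0 kap0 L0; rewrite /Pi; lra.
have cr tau : t1 <= tau -> {for tau, continuous r}.
  move=> tt1; apply: (@cvgM _ _ (nbhs tau) _ (fun=> kap) (fun tau => z tau `^ q)).
    exact: cvg_cst.
  apply: (@continuous_comp _ _ _ z (fun z => z `^ q)); first exact:
      is_derive_continuous (dz tau).
  by apply: powR_continuous_gt0; apply: lt_le_trans (z1 _ tt1).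
have r0 tau : t1 <= tau -> 0 < r tau.
  by move=> tt1; rewrite mulr_gt0// powR_gt0// (lt_le_trans ltr01)// z1.
have dPi tau : t1 <= tau -> is_derive tau 1 Pi (2 * r tau).
  move=> tt1; have z0 : 0 < z tau by apply: lt_le_trans (z1 _ tt1).
  have dzq := @der_comp _ (fun z => z `^ (q + 1)) z tau _ _ (is_derive_powR (q + 1)
      z0) (dz tau).
  apply: is_derive_eq (der_add (der_cst _ _) (der_scale _ (der_sub dzq (der_cst 1
      tau)))) _.
  rewrite (_ : q + 1 - 1 = q); last by ring.
  by rewrite /r -lamM; field; rewrite !gt_eqF.
have Pit1 : Pi t1 = 2 * r t1 * (t1 - b).
  by rewrite /Pi /r zt1 !powR1 subrr mulr0 addr0 mulr1.
have rt1 : r t1 <= eta by rewrite /r zt1 powR1 mulr1.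
have sup tau : t1 <= tau -> n%:R * r tau <= f tau + g tau * Pi tau `^ (q / 2).
  move=> tt1; have gt : g t1 <= g tau by exact: gmono.
  have gt0 : 0 <= g tau by apply: le_trans gt; exact: ltW.
  have [z2|z2] := leP (z tau) 2.
    apply: (@le_trans _ _ (f t1)).
      apply: le_trans kap2; rewrite /r mulrA ler_pM2l ?mulr_gt0//.
      by apply: ge0_ler_powR; rewrite ?nnegrE ?(ltW q0)// (le_trans ler01)// z1.
    apply: (@le_trans _ _ (f tau)); first exact: fmon.
    by rewrite lerDl mulr_ge0// powR_ge0.
  apply: (@le_trans _ _ (g tau * Pi tau `^ (q / 2))); last by rewrite lerDr ltW.
  apply: (@le_trans _ _ (g t1 * Pi tau `^ (q / 2))); last by rewrite ler_wpM2r//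
      powR_ge0.
  rewrite [leLHS](_ : _ = g t1 * (M * z tau `^ q)); last first.
    by rewrite /M /r -/N; field; rewrite gt_eqF.
  rewrite ler_pM2l//; apply: (@le_trans _ _ ((M `^ (2 / q) * z tau `^ (q + 1)) `^ (q
      / 2))).
    rewrite powRM ?powR_ge0// -!powRrM (_ : 2 / q * (q / 2) = 1); last by field;
        rewrite gt_eqF.
    (* The exponent [(q + 1) q / 2] is at least [q] because [q > 1]. *)
    rewrite (powRr1 (ltW M0)) ler_pM2l//; apply: ler_powR; first exact: z1.
    by rewrite mulrCA ler_peMr// ?(ltW q0)//; lra.
  apply: ge0_ler_powR; rewrite ?nnegrE.
  - by rewrite divr_ge0// ltW.
  - by rewrite mulr_ge0// powR_ge0.
  - by apply: le_trans (PiM _ tt1 (ltW z2)); rewrite mulr_ge0// powR_ge0.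
  - by apply: PiM => //; exact: ltW.
(* [1 / sqrt Pi] decays like [z] to the power [- (q + 1) / 2], and [(q + 1) / 2 = 1 + (q - 1) / 2]
   exceeds [1]. *)
apply: (@not_diverges_powR ((q - 1) / 2)); first by lra.
have sM0 : 0 < Num.sqrt (M `^ (2 / q)) by rewrite sqrtr_gt0.
apply: (barrier r Pi cr r0 dPi Pit1 rt1 sup u uusc usub bu _
  (Num.sqrt (M `^ (2 / q)))^-1 lam^-1 (1 - lam^-1 * t1) (t1 + lam + 1)).
- by rewrite invr_ge0 ltW.
- by rewrite invr_gt0.
- by move: lam0; lra.
- by move: lam0; lra.
- have -> : lam^-1 * (t1 + lam + 1) + (1 - lam^-1 * t1) = 2 + lam^-1 by field;
    rewrite gt_eqF.
  by have : 0 < lam^-1; [rewrite invr_gt0|lra].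
- move=> tau tau1; have tt1 : t1 <= tau by move: tau1 lam0; lra.
  rewrite [lam^-1 * tau + _](_ : _ = z tau); last by rewrite /z; ring.
  have zg : 2 <= z tau.
    have : 1 <= lam^-1 * (tau - t1).
      by rewrite -(ler_pM2l lam0) mulVKf ?gt_eqF//; lra.
    by rewrite /z; lra.
  have z0 : 0 < z tau by lra.
  have Mz0 : 0 < M `^ (2 / q) * z tau `^ (q + 1) by rewrite mulr_gt0// powR_gt0.
  rewrite -invfM lef_pV2 ?posrE ?mulr_gt0 ?powR_gt0//; last first.
    by rewrite sqrtr_gt0; apply: lt_le_trans (PiM _ tt1 zg).
  rewrite (_ : 1 + (q - 1) / 2 = (q + 1) / 2); last by field.
  rewrite [z tau `^ ((q + 1) / 2)]powRrM powR12_sqrt ?powR_ge0//.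
  by rewrite -sqrtrM ?powR_ge0// ler_wsqrtr// PiM.
Qed.

End GrowthCases.

(** * Positive [g] at infinity with [q <= 1] *)

Section GrowthSublinear.
Context {R : realType} (q : R) (f g : R -> R).
Hypotheses (q0 : 0 < q) (q1 : q <= 1).
Hypotheses (cf : continuous f) (cg : continuous g).
Hypotheses (gmono : {homo g : x y / x <= y}) (f0 : forall t, 0 < f t).
Hypothesis fincr : {homo f : x y / x < y}.
Implicit Types (t s x b c z tau : R).
Let fmon := nondecreasing_of_increasing fincr.
Local Notation G := (pospart g).

(** Up to constants and dilation, the speed at height [t]: the first term is the speed produced by
    [f] alone, the second the one produced by the gradient term alone. *)
Definition growth_rate t := Num.sqrt (t * f t) + (t * G t) `^ (1 / (2 - q)).

Let q2 : 0 < 2 - q.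
Proof. by rewrite subr_gt0 (le_lt_trans q1)// ltr1n. Qed.
Let p0 : 0 < 1 / (2 - q). Proof. by rewrite divr_gt0. Qed.

Lemma pospart_ge0 t : 0 <= G t. Proof. by rewrite /pospart le_max lexx orbT. Qed.

Lemma pospart_le x y : x <= y -> G x <= G y.
Proof. by move=> xy; rewrite /pospart ge_max !le_max gmono//= lexx orbT. Qed.

Lemma pospart_continuous : continuous G.
Proof.
move=> t; apply: (@continuous_max _ _ g (fun=> 0)); [exact: cg|exact: cvg_cst].
Qed.

Lemma growth_rate_continuous t : 0 < t -> {for t, continuous growth_rate}.
Proof.
move=> t0; apply: (@cvgD _ _ _ (nbhs t) _ (fun t => Num.sqrt (t * f t))
  (fun t => (t * G t) `^ (1 / (2 - q)))).
  exact: sqrt_mul_continuous.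
apply: (@near_eq_continuous _ (fun t => (Num.max t 0 * G t) `^ (1 / (2 - q)))
  (fun t => (t * G t) `^ (1 / (2 - q)))).
  by near=> s; rewrite max_l// ltW//; near: s; exact: lt_nbhsr.
apply: (@powR_comp_continuous _ (fun t => Num.max t 0 * G t)) => //.
  by move=> x; rewrite mulr_ge0 ?pospart_ge0// le_max lexx orbT.
apply: (@cvgM _ _ (nbhs t) _ (fun t => Num.max t 0) G); last exact: pospart_continuous.
by apply: (@continuous_max _ _ id (fun=> 0)); [exact: cvg_id|exact: cvg_cst].
Unshelve. all: by end_near. Qed.

Lemma growth_rate_gt0 t : 0 < t -> 0 < growth_rate t.
Proof. by move=> t0; rewrite ltr_wpDr ?powR_ge0// sqrtr_gt0 mulr_gt0. Qed.

Lemma growth_rate_ge0 t : 0 <= growth_rate t.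
Proof. by rewrite addr_ge0 ?sqrtr_ge0 ?powR_ge0. Qed.

Lemma inv_growth_rate_continuous t : 0 < t ->
  {for t, continuous (fun t => (growth_rate t)^-1)}.
Proof.
move=> t0; apply: (@cvgV _ _ (nbhs t) _ growth_rate).
  by rewrite gt_eqF// growth_rate_gt0.
exact: growth_rate_continuous.
Qed.

Lemma growth_integral :
  (\int[lebesgue_measure]_(t in [set t : R | (0 <= t)%R])
    ((powR (t * f t) (1/2) + powR (t * pospart g t) (1 / (2 - q)))^-1)%R%:E = +oo)%E <->
  diverges (fun t => (growth_rate t)^-1).
Proof.
rewrite -(@integral_diverges _ _ (Num.sqrt (f 0))^-1).
- rewrite [X in X = _ <-> _](_ : _ = (\int[lebesgue_measure]_(t in [set t : R | (0 <=
    t)%R])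
    ((growth_rate t)^-1)%:E)%E)//.
  by apply: eq_integral => t; rewrite inE/= => t0; rewrite powR_half// mulr_ge0// ltW.
- by move=> t t0; exact: inv_growth_rate_continuous.
- by move=> t _; rewrite invr_ge0 growth_rate_ge0.
- move=> t /andP[t0 t1]; apply: le_trans (inv_sqrt_mul_le f0 fincr t0).
  rewrite lef_pV2 ?posrE ?growth_rate_gt0 ?sqrtr_gt0 ?mulr_gt0//.
  by rewrite lerDl powR_ge0.
Qed.

Lemma powR_conj_sqr x : 0 <= x -> Num.sqrt (x `^ (2 / (2 - q))) = x `^ (1 / (2 - q)).
Proof.
move=> x0; rewrite -powR12_sqrt ?powR_ge0// -powRrM; congr (_ `^ _).
by field; rewrite gt_eqF.
Qed.

Lemma growth_exists n : (0 < n)%N ->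
  diverges (fun t => (growth_rate t)^-1) ->
  exists u : 'rV[R]_n -> R, usc u /\ visc_subsol f g q u.
Proof.
move=> n0 div.
have pq0 : 0 < q / (2 - q) by rewrite divr_gt0.
pose base t := Num.max t 0 * G t.
have base0 t : 0 <= base t by rewrite mulr_ge0 ?pospart_ge0// le_max lexx orbT.
have cbase : continuous base.
  move=> t; apply: (@cvgM _ _ (nbhs t) _ (fun t => Num.max t 0) G); last exact:
      pospart_continuous.
  by apply: (@continuous_max _ _ id (fun=> 0)); [exact: cvg_id|exact: cvg_cst].
(* The exponent [q / (2 - q)] is that of [P ^ (q / 2)] for [P] of order [(t G) ^ (2 / (2 - q))]. The
   constant is [1 + 3]: [t f] costs at most [X + Y], and since [P <= 8 (X + Y)] and
   [8 ^ (q / 2) <= 3], [t] times the gradient term costs at most [3 (X + Y)]. *)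
pose rho t := 4 * (f t + G t * base t `^ (q / (2 - q))).
have crho : continuous rho.
  move=> t; apply: (@cvgM _ _ (nbhs t) _ (fun=> 4) (fun t => f t + G t * base t `^ (q
      / (2 - q)))).
    exact: cvg_cst.
  apply: (@cvgD _ _ _ (nbhs t) _ f (fun t => G t * base t `^ (q / (2 - q)))); first
      exact: cf.
  apply: (@cvgM _ _ (nbhs t) _ G (fun t => base t `^ (q / (2 - q)))).
    exact: pospart_continuous.
  by apply: (@powR_comp_continuous _ base) => //; exact: cbase.
have rho0 t : 0 < rho t.
  by rewrite mulr_gt0// ltr_wpDr// mulr_ge0 ?pospart_ge0// powR_ge0.
have c2rho : continuous (fun t => 2 * rho t).
  by move=> t; apply: (@cvgM _ _ (nbhs t) _ (fun=> 2) rho); [exact: cvg_cst|exact: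
      crho].
have [P P0 dP] := antiderivative c2rho.
have Pgt0 := primitive_gt0 P0 dP (fun t _ => rho0 t).
have rhomono x y : 0 <= x -> x <= y -> rho x <= rho y.
  move=> x0 xy; rewrite ler_pM2l// lerD ?fmon//.
  apply: ler_pM; rewrite ?pospart_ge0 ?powR_ge0 ?pospart_le//.
  apply: ge0_ler_powR; rewrite ?nnegrE ?base0 ?(ltW pq0)//.
  apply: ler_pM; [by rewrite le_max lexx orbT|exact: pospart_ge0| |exact: pospart_le].
  by rewrite ge_max !le_max xy lexx orbT.
pose X t := t * f t; pose Y t := (t * G t) `^ (2 / (2 - q)).
have X0 t : 0 < t -> 0 < X t by move=> t0; rewrite mulr_gt0.
have Y0 t : 0 <= Y t by exact: powR_ge0.
(* [sqrt (X t) + sqrt (Y t)] is the growth rate, and [rho] is chosen so that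
   [t * rho t] is proportional to [X t + Y t]. *)
have trho t : 0 <= t -> t * rho t = 4 * (X t + Y t).
  move=> t0; rewrite /rho /base max_l// /X /Y.
  rewrite -[in RHS]mulr_powRB1 ?mulr_ge0 ?pospart_ge0//; last by rewrite divr_gt0.
  rewrite (_ : 2 / (2 - q) - 1 = q / (2 - q)); last by field; rewrite gt_eqF.
  by move: (_ `^ _) => w; ring.
have PXY t : 0 <= t -> P t <= 8 * (X t + Y t).
  move=> t0; have dl x : 0 <= x <= t ->
      is_derive x 1 (fun x => 2 * rho t * x - P x) (2 * rho t * 1 - 2 * rho x).
    by move=> _; apply: der_sub (der_scale _ (der_id x)) (dP x).
  have : 2 * rho t * 0 - P 0 <= 2 * rho t * t - P t.
    apply: ger_derive t0 dl _ => x /andP[x0 xt].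
    by rewrite mulr1 -mulrBr mulr_ge0// subr_ge0 rhomono// ltW.
  by rewrite P0; have := trho t t0; lra.
apply: (exists_subsol (rho := rho) (P := P) (a := 0)) => //.
- apply: (diverges_le (C := Num.sqrt 8) (k := 1) (s := 0) (c := 1) _ _ _ _ _ _ _ div).
  + exact: sqrtr_ge0.
  + by [].
  + by [].
  + by lra.
  + move=> t t1; apply: inv_growth_rate_continuous; exact: lt_le_trans t1.
  + by move=> t _; rewrite invr_ge0 growth_rate_ge0.
  + move=> t t1; have t0 : 0 < t by apply: lt_le_trans t1.
    rewrite mul1r addr0 ler_pdivlMr ?sqrtr_gt0 ?Pgt0// mulrC.
    rewrite ler_pdivrMr ?growth_rate_gt0//.
    apply: le_trans (ler_wsqrtr (PXY t (ltW t0))) _.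
    rewrite sqrtrM// ler_wpM2l ?sqrtr_ge0//.
    apply: le_trans (ler_sqrtD (ltW (X0 t t0)) (Y0 t)) _.
    by rewrite /growth_rate powR_conj_sqr// mulr_ge0 ?pospart_ge0// ltW.
move=> t; rewrite add0r le_eqVlt => /predU1P[<-|t0].
  rewrite P0 powR0 ?mulr0 ?addr0; last by rewrite gt_eqF// divr_gt0.
  have := f0 0; rewrite /rho.
  by have := mulr_ge0 (pospart_ge0 0) (powR_ge0 (base 0) (q / (2 - q))); lra.
have S0 : 0 < X t + Y t by rewrite ltr_wpDr// X0.
rewrite -(ler_pM2l t0) (trho _ (ltW t0)) mulrDr -/(X t).
have gG : t * (g t * P t `^ (q / 2)) <= t * G t * P t `^ (q / 2).
  rewrite -mulrA ler_pM2l// ler_wpM2r ?powR_ge0//.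
  by rewrite /pospart le_max lexx.
have e8 : (8 : R) `^ (q / 2) <= 3.
  apply: (@le_trans _ _ ((8 : R) `^ (1 / 2))).
    by apply: ler_powR; [rewrite ler1n|rewrite ler_pM2r].
  rewrite powR_half// -[leRHS]ger0_norm// -sqrtr_sqr ler_wsqrtr//.
  by rewrite -natrX ler_nat.
(* The exponents [(2 - q) / 2] and [q / 2] add up to [1], so the product with [P ^ (q / 2)] is
   linear in [X + Y]. *)
have tGY : t * G t <= (X t + Y t) `^ ((2 - q) / 2).
  have tG0 : 0 <= t * G t by rewrite mulr_ge0 ?pospart_ge0// ltW.
  have -> : t * G t = Y t `^ ((2 - q) / 2).
    rewrite /Y -powRrM (_ : 2 / (2 - q) * ((2 - q) / 2) = 1) ?powRr1//.
    by field; rewrite gt_eqF.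
  apply: ge0_ler_powR; rewrite ?nnegrE ?(ltW S0) ?Y0//.
    by rewrite divr_ge0// ltW.
  by rewrite lerDr ltW// X0.
have PS : P t `^ (q / 2) <= 3 * (X t + Y t) `^ (q / 2).
  apply: (@le_trans _ _ ((8 * (X t + Y t)) `^ (q / 2))).
    apply: ge0_ler_powR; rewrite ?nnegrE.
    - by rewrite divr_ge0// ltW.
    - exact: ltW (Pgt0 t t0).
    - by rewrite mulr_ge0// ltW.
    - exact: PXY (ltW t0).
  by rewrite powRM ?(ltW S0)// ler_wpM2r ?powR_ge0.
have : t * G t * P t `^ (q / 2) <= 3 * (X t + Y t).
  apply: (@le_trans _ _ ((X t + Y t) `^ ((2 - q) / 2) * (3 * (X t + Y t) `^ (q / 2)))).
    by apply: ler_pM; rewrite ?powR_ge0// mulr_ge0 ?pospart_ge0// ltW.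
  rewrite mulrCA -powRD; last by rewrite (gt_eqF S0) implybT.
  by rewrite (_ : (2 - q) / 2 + q / 2 = 1) ?powRr1 ?(ltW S0)//; field.
by have := Y0 t; have := X0 t t0; lra.
Qed.

Lemma growth_diverges n t1' (u : 'rV[R]_n -> R) : (0 < n)%N ->
  0 < g t1' -> usc u -> visc_subsol f g q u ->
  diverges (fun t => (growth_rate t)^-1).
Proof.
move=> n0 gt1' uusc usub.
(* With [t1 >= 1] the dilated variable [tau / 2] is at least [1] for [tau >= 2 * t1]. *)
pose t1 := Num.max t1' 1.
have t11 : 1 <= t1 by rewrite le_max lexx orbT.
have gam0 : 0 < g t1 by apply: lt_le_trans gt1' _; apply: gmono; rewrite le_max lexx.
pose b := Num.min (u 0) t1 - 1.
have bu : b < u 0 by have : Num.min (u 0) t1 <= u 0; [rewrite ge_min lexx|rewrite /b;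
    lra].
have bt1' : 1 + b <= t1 by have : Num.min (u 0) t1 <= t1; [rewrite ge_min lexx
    orbT|rewrite /b; lra].
have bt1 : b < t1 by lra.
pose L := t1 - b; have L0 : 0 < L by rewrite subr_gt0.
have [eta eta0 barrier] := growth_barrier q0 gmono f0 fincr n0 bt1 gam0.
pose N : R := n%:R; have N0 : 0 < N by rewrite ltr0n.
have N1 : 1 <= N by rewrite ler1n.
pose p := q / (2 - q); have pp0 : 0 < p by rewrite divr_gt0.
(* Half of the allowance [eta] goes to the [f] part [a * f t1 = eps] of [r t1]; the other bound
   gives [N * a <= 1]. *)
pose eps := Num.min (eta / 2) (f t1 / N).
have eps0 : 0 < eps by rewrite lt_min !divr_gt0.
have eps1 : eps <= eta / 2 by rewrite ge_min lexx.
have eps2 : N * eps <= f t1.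
  by rewrite mulrC -ler_pdivlMr// ge_min lexx orbT.
(* As [A <= 1] and [q <= 1], [A ^ (q / 2) >= A ^ (1 / 2) = N * A], which pays for the factor [N]. *)
pose A := N ^- 2; have A0 : 0 < A by rewrite invr_gt0 exprn_gt0.
(* The first bound keeps the constant subtracted in [Pi] below [2 * r t1 * L]; the second keeps the
   gradient part of [r t1] below [eta / 2]. *)
pose delta := Num.min (2 * L * g t1 / (2 - q)) ((eta / 2 / (A * g t1)) `^ p^-1).
have B0 : 0 < eta / 2 / (A * g t1) by rewrite !divr_gt0// mulr_gt0.
have delta0 : 0 < delta.
  by rewrite lt_min powR_gt0// divr_gt0// !mulr_gt0.
have delta1 : (2 - q) * delta <= 2 * L * g t1.
  by rewrite mulrC -ler_pdivlMr// ge_min lexx.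
have delta2 : A * (delta `^ p) * g t1 <= eta / 2.
  rewrite mulrAC mulrC -ler_pdivlMr ?mulr_gt0//.
  have -> : eta / 2 / (A * g t1) = ((eta / 2 / (A * g t1)) `^ p^-1) `^ p.
    by rewrite -powRrM mulVf ?gt_eqF// powRr1// ltW.
  apply: ge0_ler_powR; rewrite ?nnegrE ?powR_ge0 ?(ltW pp0) ?(ltW delta0)//.
  by rewrite ge_min lexx orbT.
have [F _ dF] := antiderivative cf.
have [Gam _ dGam] := antiderivative pospart_continuous.
have Gmono x y : x <= y -> Gam x <= Gam y.
  by move=> xy; apply: ger_derive xy (fun z _ => dGam z) _ => z _; exact: pospart_ge0.
(* Starting from [delta > 0] rather than [0] keeps the powers differentiable at
   [t1]; the loss is absorbed by the speed accumulated below [t1]. *)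
pose GG tau := delta + (Gam tau - Gam t1).
have GG0 tau : t1 <= tau -> 0 < GG tau.
  by move=> /Gmono h; rewrite ltr_wpDr// subr_ge0.
have dGG tau : is_derive tau 1 GG (G tau).
  apply: is_derive_eq (der_add (der_cst _ _) (der_sub (dGam tau) (der_cst _ _))) _.
  by rewrite add0r subr0.
have GGt1 : GG t1 = delta by rewrite /GG subrr addr0.
have Gt1 : G t1 = g t1 by rewrite /pospart max_l// ltW.
pose a := eps / f t1; have a0 : 0 < a by rewrite divr_gt0.
(* Since [GG' = G] and [p + 1 = 2 / (2 - q)], the last term has a power of [GG] as primitive, and
   raising that power to [q / 2] gives back [GG ^ p]. *)
pose r tau := a * f tau + A * GG tau `^ p * G tau.
pose Pi tau := 2 * r t1 * L + 2 * a * (F tau - F t1)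
  + (2 - q) * A * (GG tau `^ (2 / (2 - q)) - delta `^ (2 / (2 - q))).
have cr tau : t1 <= tau -> {for tau, continuous r}.
  move=> tt1; apply: (@cvgD _ _ _ (nbhs tau) _ (fun tau => a * f tau) (fun tau => A *
      GG tau `^ p * G tau)).
    by apply: (@cvgM _ _ (nbhs tau) _ (fun=> a) f); [exact: cvg_cst|exact: cf].
  apply: (@cvgM _ _ (nbhs tau) _ (fun tau => A * GG tau `^ p) G); last exact:
      pospart_continuous.
  apply: (@cvgM _ _ (nbhs tau) _ (fun=> A) (fun tau => GG tau `^ p)); first exact:
      cvg_cst.
  apply: (@continuous_comp _ _ _ GG (fun z => z `^ p)); first exact:
      is_derive_continuous (dGG tau).
  by apply: powR_continuous_gt0; exact: GG0.
have r0 tau : t1 <= tau -> 0 < r tau.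
  move=> tt1; apply: ltr_wpDr; last exact: mulr_gt0.
  by rewrite !mulr_ge0 ?pospart_ge0 ?powR_ge0// ltW.
have dPi tau : t1 <= tau -> is_derive tau 1 Pi (2 * r tau).
  move=> tt1.
  have dGGp := @der_comp _ (fun z => z `^ (2 / (2 - q))) GG tau _ _
    (is_derive_powR (2 / (2 - q)) (GG0 tau tt1)) (dGG tau).
  apply: is_derive_eq (der_add (der_add (der_cst _ _) (der_scale (2 * a) (der_sub (dF
      tau) (der_cst (F t1) tau))))
    (der_scale ((2 - q) * A) (der_sub dGGp (der_cst (delta `^ (2 / (2 - q))) tau)))) _.
  rewrite (_ : 2 / (2 - q) - 1 = p); last by rewrite /p; field; rewrite gt_eqF.
  by rewrite /r; field; rewrite gt_eqF.
have Pit1 : Pi t1 = 2 * r t1 * (t1 - b).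
  by rewrite /Pi GGt1 !subrr !mulr0 !addr0.
have rt1 : r t1 <= eta.
  rewrite /r GGt1 Gt1 /a divfK ?gt_eqF//; lra.
have deltap : delta `^ (2 / (2 - q)) = delta * delta `^ p.
  rewrite -mulr_powRB1 ?(ltW delta0) ?divr_gt0//; congr (_ * _ `^ _).
  by rewrite /p; field; rewrite gt_eqF.
have Pilow tau : t1 <= tau ->
    2 * a * (F tau - F t1) + A * GG tau `^ (2 / (2 - q)) <= Pi tau.
  move=> tt1; rewrite /Pi deltap.
  have h1 : A * GG tau `^ (2 / (2 - q)) <= (2 - q) * A * GG tau `^ (2 / (2 - q)).
    rewrite -mulrA ler_peMl ?mulr_ge0 ?powR_ge0 ?(ltW A0)//.
    by have := q1; lra.
  have h2 : (2 - q) * A * (delta * delta `^ p) <= 2 * r t1 * L.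
    have Ad0 : 0 < A * delta `^ p by rewrite mulr_gt0// powR_gt0.
    have := ler_wpM2l (ltW Ad0) delta1.
    have : A * delta `^ p * g t1 <= r t1.
      by rewrite /r GGt1 Gt1 lerDr mulr_ge0// ltW.
    move=> /(ler_wpM2r (ltW L0)); lra.
  lra.
have Fmono x y : x <= y -> F x <= F y.
  by move=> xy; apply: ger_derive xy (fun z _ => dF z) _ => z _; exact: ltW.
have sup tau : t1 <= tau -> n%:R * r tau <= f tau + g tau * Pi tau `^ (q / 2).
  move=> tt1; have gt : 0 < g tau by apply: lt_le_trans gam0 _; exact: gmono.
  have Gt : G tau = g tau by rewrite /pospart max_l// ltW.
  rewrite -/N /r mulrDr lerD//.
    rewrite mulrA ger_pMl// /a mulrA ler_pdivrMr// mul1r.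
    exact: eps2.
  rewrite Gt mulrA mulrC ler_pM2l//.
  have GGp0 := powR_ge0 (GG tau) (2 / (2 - q)).
  have Ff0 : 0 <= 2 * a * (F tau - F t1).
    by rewrite mulr_ge0 ?subr_ge0 ?Fmono// mulr_ge0// ltW.
  have AGG0 : 0 <= A * GG tau `^ (2 / (2 - q)) by rewrite mulr_ge0// ltW.
  apply: (@le_trans _ _ ((A * GG tau `^ (2 / (2 - q))) `^ (q / 2))).
    rewrite powRM ?(ltW A0)// -powRrM (_ : 2 / (2 - q) * (q / 2) = p); last by
        rewrite /p; field; rewrite gt_eqF.
    rewrite mulrA ler_wpM2r ?powR_ge0//.
    apply: (@le_trans _ _ (A `^ (1 / 2))).
      rewrite powR_half ?(ltW A0)// /A -exprVn sqrtr_sqr ger0_norm ?invr_ge0 ?(ltW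
          N0)//.
      by rewrite expr2 mulVKf// gt_eqF.
    apply: ger_powR; last by rewrite ler_pM2r// invr_gt0.
    by rewrite A0 /A invf_le1 ?exprn_gt0// exprn_ege1.
  apply: ge0_ler_powR; rewrite ?nnegrE.
  - by rewrite divr_ge0// ltW.
  - by rewrite mulr_ge0// ltW.
  - by apply: le_trans (Pilow _ tt1); exact: addr_ge0.
  - by apply: le_trans (Pilow _ tt1); rewrite lerDr.
pose c := Num.min (2 * a) A.
have c0 : 0 < c by rewrite lt_min A0 mulr_gt0.
have sc0 : 0 < Num.sqrt c by rewrite sqrtr_gt0.
apply: (barrier r Pi cr r0 dPi Pit1 rt1 sup u uusc usub bu
  (fun t => (growth_rate t)^-1) (2 / Num.sqrt c) 2^-1 0 (2 * t1)).
- by rewrite divr_ge0// ltW.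
- by [].
- by lra.
- by lra.
- by lra.
move=> tau tau1; rewrite addr0; set s := 2^-1 * tau.
have s1 : t1 <= s by rewrite /s; lra.
have s0 : 0 < s by apply: lt_le_trans s1; lra.
have st : s <= tau by rewrite /s; lra.
have tauE : tau - s = s by rewrite /s; field.
(* A nonnegative nondecreasing integrand contributes over [[s, tau]] at least its value at [s] times
   the length [tau - s = s]. *)
have prim (H h : R -> R) : (forall t, is_derive t 1 H (h t)) ->
    (forall x y, x <= y -> h x <= h y) -> (forall x, 0 <= h x) -> s * h s <= H tau -
        H t1.
  move=> dH hm h0.
  have Hs : H t1 <= H s by apply: ger_derive s1 (fun z _ => dH z) _ => z _; exact: h0.
  have dl x : s <= x <= tau -> is_derive x 1 (fun x => H x - h s * x) (h x - h s * 1).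
    by move=> _; apply: der_sub (dH x) (der_scale _ (der_id x)).
  have : H s - h s * s <= H tau - h s * tau.
    apply: ger_derive st dl _ => x /andP[sx _].
    by rewrite mulr1 subr_ge0 hm// ltW.
  have : h s * tau - h s * s = s * h s by rewrite -mulrBr tauE mulrC.
  lra.
have FX : s * f s <= F tau - F t1.
  by apply: prim dF _ _ => [x y|x]; [exact: fmon|exact: ltW].
have GY : s * G s <= GG tau.
  apply: (@le_trans _ _ (Gam tau - Gam t1)); last by rewrite lerDr ltW.
  by apply: prim dGam _ _; [exact: pospart_le|exact: pospart_ge0].
have sG0 : 0 <= s * G s by rewrite mulr_ge0 ?pospart_ge0// ltW.
pose X := s * f s; pose Y := (s * G s) `^ (2 / (2 - q)).
have X0 : 0 < X by rewrite mulr_gt0.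
have Y0 : 0 <= Y by exact: powR_ge0.
have tt1 : t1 <= tau by apply: le_trans st.
have PiXY : c * (X + Y) <= Pi tau.
  apply: le_trans (Pilow _ tt1).
  have hY : Y <= GG tau `^ (2 / (2 - q)).
    apply: ge0_ler_powR; rewrite ?nnegrE ?(ltW (GG0 _ tt1))//.
    by rewrite divr_ge0// ltW.
  have ca : c <= 2 * a by rewrite ge_min lexx.
  have cA : c <= A by rewrite ge_min lexx orbT.
  rewrite mulrDr lerD//.
    apply: le_trans (ler_wpM2r (ltW X0) ca) _.
    by rewrite ler_wpM2l// mulr_ge0// ltW.
  apply: le_trans (ler_wpM2r Y0 cA) _.
  by rewrite ler_wpM2l// ltW.
have XY0 : 0 < X + Y by rewrite ltr_wpDr.
have Pi0 : 0 < Pi tau by apply: lt_le_trans PiXY; rewrite mulr_gt0.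
have sXY : growth_rate s <= 2 * Num.sqrt (X + Y).
  rewrite /growth_rate -powR_conj_sqr// -/X -/Y.
  have : Num.sqrt X <= Num.sqrt (X + Y) by rewrite ler_wsqrtr// lerDl.
  have : Num.sqrt Y <= Num.sqrt (X + Y) by rewrite ler_wsqrtr// lerDr ltW.
  lra.
have gr0 := growth_rate_gt0 s0.
rewrite ler_pdivlMr// mulrC ler_pdivrMr ?sqrtr_gt0//.
apply: le_trans sXY _; rewrite -mulrA ler_pM2l// mulrC ler_pdivlMr//.
by rewrite mulrC -sqrtrM ?(ltW c0)// ler_wsqrtr.
Qed.

End GrowthSublinear.

(** * Sign of [g] read from its limit *)

Section LimitAtInfinity.
Context {R : realType} (g : R -> R).
Hypothesis gmono : {homo g : x y / x <= y}.

Lemma nondecreasing_le_limit (l : \bar R) :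
  (g t)%:E @[t --> +oo] --> l -> forall t, ((g t)%:E <= l)%E.
Proof.
move=> gl t; apply: cvge_to_ge gl _.
by near=> x; rewrite lee_fin gmono//; near: x; exact: nbhs_pinfty_ge.
Unshelve. all: by end_near. Qed.

Lemma limit_gt0_exists (l : \bar R) :
  (g t)%:E @[t --> +oo] --> l -> (0 < l)%E -> exists t, 0 < g t.
Proof.
move=> gl l0; apply: contrapT => /forallNP gle; move: l0; apply/negP.
rewrite -leNgt; apply: cvge_to_le gl _.
by apply: nearW => t; rewrite lee_fin leNgt; apply/negP; exact: gle.
Qed.

(** A nondecreasing function stays below its limit, which excludes [-oo]; the bound is the limit
    itself. *)
Lemma limit_lt0_bound (l : \bar R) :
  (g t)%:E @[t --> +oo] --> l -> (l < 0)%E ->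
  exists2 c, 0 < c & forall t, g t <= - c.
Proof.
move=> /nondecreasing_le_limit; case: l => [r| |] gle //; last first.
  by have := gle 0; rewrite leeNy_eq.
by rewrite lte_fin => r0; exists (- r); rewrite ?oppr_gt0// => t; rewrite opprK
    -lee_fin.
Qed.

End LimitAtInfinity.

Theorem theorem3p3 (R : realType) (n : nat) (q : R) (f g : R -> R) :
  (0 < n)%N -> 0 < q -> q <= 2 ->
  continuous f -> continuous g ->
  {homo g : x y / x <= y} ->
  (forall t, 0 < f t) -> {homo f : x y / x < y} ->
  (* (i) *)
  (forall l : \bar R, (g t)%:E @[t --> +oo] --> l -> (0 < l)%E ->
    ((exists u : 'rV[R]_n -> R, usc u /\ visc_subsol f g q u) <->
     (q <= 1 /\
      (\int[lebesgue_measure]_(t in [set t : R | (0 <= t)%R])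
         ((powR (t * f t) (1/2) + powR (t * pospart g t) (1 / (2 - q)))^-1)%R%:E
       = +oo)%E))) /\
  (* (ii) *)
  ((g t)%:E @[t --> +oo] --> 0%E ->
    ((exists u : 'rV[R]_n -> R, usc u /\ visc_subsol f g q u) <->
     (\int[lebesgue_measure]_(t in [set t : R | (0 <= t)%R])
        ((powR (\int[lebesgue_measure]_(s in [set s : R | (0 <= s <= t)%R])
              (expR (- 2 * \int[lebesgue_measure]_(tau in [set tau : R | (s <= tau <= t)%R])
                         (powR (negpart g tau / f tau) (2 / q) * f tau))
               * f s)) (1/2))^-1)%R%:E
      = +oo)%E)) /\
  (* (iii) *)
  (forall l : \bar R, (g t)%:E @[t --> +oo] --> l -> (l < 0)%E ->
    ((exists u : 'rV[R]_n -> R, usc u /\ visc_subsol f g q u) <->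
     (\int[lebesgue_measure]_(t in [set t : R | (0 <= t)%R])
        ((powR (t * f t) (1/2))^-1 + (powR (f t) (1 / q))^-1)%R%:E
      = +oo)%E)).
Proof.
move=> n0 q0 q2 cf cg gmono f0 fincr.
have ck := absorption_continuous q0 cf cg f0.
have kdec := absorption_noninc q0 gmono f0 fincr.
have [P [P0 dP P1 PE]] := weighted_primitive cf ck f0 kdec.
(* Parts (ii) and (iii) share this criterion and differ only in how the divergence for [P] is
   rewritten. *)
have nonpos : (forall t, g t <= 0) ->
    (exists u : 'rV[R]_n -> R, usc u /\ visc_subsol f g q u) <->
    diverges (fun t => (Num.sqrt (P t))^-1).
  move=> g0; split.
    exact: (absorption_diverges q0 cf cg gmono f0 fincr P0 dP P1 g0 n0).
  exact: (absorption_exists q0 q2 cf cg f0 P0 dP P1 g0 n0).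
split; [|split].
- move=> l gl l0; have [t1 gt1] := limit_gt0_exists gl l0; split.
    move=> [u [uusc usub]]; have q1 : q <= 1.
      rewrite leNgt; apply/negP => q1.
      exact: (growth_superlinear_no_subsol q0 gmono f0 fincr n0 q1 gt1 uusc usub).
    split => //; apply/(growth_integral q1 cf cg f0 fincr).
    exact: (growth_diverges q0 q1 cf cg gmono f0 fincr n0 gt1 uusc usub).
  move=> [q1 /(growth_integral q1 cf cg f0 fincr)].
  exact: (growth_exists q0 q1 cf cg gmono f0 fincr n0).
- move=> /(nondecreasing_le_limit gmono) gle.
  have g0 t : g t <= 0 by rewrite -lee_fin.
  have eq_iff (x y : \bar R) : x = y -> (x = +oo%E <-> y = +oo%E) by move->.
  apply: (iff_trans (nonpos g0)).
  apply: (iff_trans (iff_sym (weighted_integral q0 cf cg f0 P0 dP P1))).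
  apply/eq_iff/eq_integral => t; rewrite inE/= => t0.
  by congr ((_ `^ _)^-1)%:E; exact/esym/PE.
- move=> l gl l0; have [c c0 gc] := limit_lt0_bound gmono gl l0.
  have g0 t : g t <= 0 by apply: le_trans (gc t) _; rewrite oppr_le0 ltW.
  apply: (iff_trans (nonpos g0)); rewrite (bounded_absorption_integral q0 cf f0 fincr).
  split; first exact: (diverges_bounded_of_weighted q0 gmono f0 fincr P0 dP P1 c0 gc).
  exact: (diverges_weighted_of_bounded q0 cf f0 fincr P0 dP P1 c0 gc).
Qed.
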